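(* (Effective Choquet Capacity Theorem.) If $\mathcal{T}$ is a computable capacity (with $\mathcal{T}(\{0,1\}^{\mathbb{N}})=1$), then there is a computable $d:\{0,1,2\}^*\to[0,1]$ with $d(\lambda)=1$ and $d(\sigma)=\sum_{i=0}^2d(\sigma^\frown i)$ for all $\sigma$, such that $\mathcal{T}=\mathcal{T}_d$, where $\mathcal{T}_d(Q)=\mu_d^*(\{K\in\mathcal{C}:K\cap Q\neq\emptyset\})$.
   Context: $\mathcal{C}$ is the space of nonempty closed subsets of $\{0,1\}^{\mathbb{N}}$. For a nonempty closed $Q$, $T_Q=\{\sigma: Q\cap I(\sigma)\neq\emptyset\}$ where $I(\sigma)$ is the set of infinite sequences extending $\sigma$; enumerate $T_Q$ as $\sigma_0,\sigma_1,\ldots$ by length then lexicographically, and let $x_Q\in\{0,1,2\}^{\mathbb{N}}$ have $x_Q(n)=2$ if both $\sigma_n^\frown0,\sigma_n^\frown1\in T_Q$, $1$ if only $\sigma_n^\frown1\in T_Q$, $0$ if only $\sigma_n^\frown0\in T_Q$. $\mu_d$ is the Borel probability measure on $\{0,1,2\}^{\mathbb{N}}$ with $\mu_d(I(\sigma))=d(\sigma)$, and $\mu_d^*(\mathcal{X})=\mu_d(\{x_Q:Q\in\mathcal{X}\})$. A capacity is a function $\mathcal{T}$ from closed subsets of $\{0,1\}^{\mathbb{N}}$ to $[0,1]$ with $\mathcal{T}(\emptyset)=0$ such that (i) it is monotone increasing under inclusion; (ii) for $n\geq2$ and closed $Q_1,\dots,Q_n$, $\mathcal{T}(\bigcap_{i=1}^nQ_i)\leq\sum\{(-1)^{|I|+1}\mathcal{T}(\bigcup_{i\in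 I}Q_i):\emptyset\neq I\subseteq\{1,\dots,n\}\}$; (iii) $\mathcal{T}(\bigcap_nQ_n)=\lim_n\mathcal{T}(Q_n)$ for decreasing sequences of closed sets. The paper assumes throughout that capacities satisfy $\mathcal{T}(\{0,1\}^{\mathbb{N}})=1$. A capacity is computable if there is a computable function $F$ from the Boolean algebra of clopen subsets of $\{0,1\}^{\mathbb{N}}$ to $[0,1]$ with $F(B)=\mathcal{T}(B)$ for every clopen $B$. The measure $\mu_d^*$ is called computable when $d$ is computable. *)

(* Defs.v *)
From HB Require Import structures.
From mathcomp Require Import all_boot all_order all_algebra.
From mathcomp Require Import all_classical all_reals all_analysis.
Import Order.TTheory GRing.Theory Num.Theory numFieldNormedType.Exports.

Set Implicit Arguments.
Unset Strict Implicit.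
Unset Printing Implicit Defensive.

Local Open Scope classical_set_scope.
Local Open Scope ring_scope.

(* Total recursive functions of [k] natural number arguments: closure of the
   basic functions under composition, primitive recursion and minimization of
   functions having a zero for all values of the parameters. *)
Inductive recursive : forall k : nat, (k.-tuple nat -> nat) -> Prop :=
| recursive_zero k :
    recursive (fun _ : k.-tuple nat => 0%N)
| recursive_succ :
    recursive (fun x : 1.-tuple nat => (tnth x ord0).+1)
| recursive_proj k (i : 'I_k) :
    recursive (fun x : k.-tuple nat => tnth x i)
| recursive_comp k m (f : m.-tuple nat -> nat)
    (g : 'I_m -> k.-tuple nat -> nat) :
    recursive f -> (forall i, recursive (g i)) ->
    recursive (fun x : k.-tuple nat => f [tuple g i x | i < m])
| recursive_prim k (f : k.-tuple nat -> nat) (g : k.+2.-tuple nat -> nat)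
    (h : k.+1.-tuple nat -> nat) :
    recursive f -> recursive g ->
    (forall x : k.-tuple nat, h [tuple of 0%N :: x] = f x) ->
    (forall n (x : k.-tuple nat),
      h [tuple of n.+1 :: x] = g [tuple of [:: n, h [tuple of n :: x] & x]]) ->
    recursive h
| recursive_min k (f : k.+1.-tuple nat -> nat) (g : k.-tuple nat -> nat) :
    recursive f ->
    (forall x, f [tuple of g x :: x] = 0%N /\
      forall y, (y < g x)%N -> f [tuple of y :: x] <> 0%N) ->
    recursive g.

(* A real-valued [f] is computable, relatively to the coding [c] of its
   arguments by natural numbers, when some recursive sequence of rationals
   (signed numerator [p - q], denominator [r + 1]) approximates [f x] to within
   [2 ^- n], uniformly in [x]. *)
Definition computable_real_fun (R : realType) (X : Type) (c : X -> nat)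
    (f : X -> R) : Prop :=
  exists p q r : 2.-tuple nat -> nat,
    [/\ recursive p, recursive q, recursive r &
      forall x n, `|f x - ((p [tuple c x; n])%:R - (q [tuple c x; n])%:R)
                          / (r [tuple c x; n]).+1%:R| <= 2 ^- n].

Definition code_bitstring (s : seq bool) : nat :=
  CodeSeq.code [seq nat_of_bool b | b <- s].

Definition code_bitstrings (L : seq (seq bool)) : nat :=
  CodeSeq.code [seq code_bitstring s | s <- L].

Definition code_tritstring (s : seq 'I_3) : nat :=
  CodeSeq.code [seq nat_of_ord i | i <- s].

(* The infinite sequences extending the finite sequence [s]. *)
Definition cylinder (A : Type) (s : seq A) : set (nat -> A) :=
  [set x | mkseq x (size s) = s].

Definition clopen_of (L : seq (seq bool)) : set cantor_space :=
  [set x | exists2 s, s \in L & cylinder s x].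

Definition is_capacity (R : realType) (T : set cantor_space -> R) : Prop :=
  [/\ (forall Q, closed Q -> 0 <= T Q <= 1),
      T set0 = 0,
      (forall Q1 Q2, closed Q1 -> closed Q2 -> Q1 `<=` Q2 -> T Q1 <= T Q2),
      (forall (n : nat) (Q : 'I_n -> set cantor_space), (2 <= n)%N ->
        (forall i, closed (Q i)) ->
        T (\bigcap_i Q i) <=
        \sum_(J : {set 'I_n} | J != finset.set0)
          (-1) ^+ #|J|.+1 * T (\bigcup_(i in [set i | i \in J]) Q i)) &
      (forall Q : nat -> set cantor_space, (forall n, closed (Q n)) ->
        (forall n, Q n.+1 `<=` Q n) ->
        T (Q n) @[n --> \oo] --> T (\bigcap_n Q n))].

(* Clopen sets are coded by finite sets of strings; by compactness every clopen
   set is some [clopen_of L]. *)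
Definition computable_capacity (R : realType) (T : set cantor_space -> R) :
    Prop :=
  exists F : set cantor_space -> R,
    computable_real_fun code_bitstrings (fun L => F (clopen_of L)) /\
    forall B, clopen B -> F B = T B.

Definition hyperspace : set (set cantor_space) :=
  [set K | closed K /\ K !=set0].

Definition tree (Q : set cantor_space) : set (seq bool) :=
  [set s | Q `&` cylinder s !=set0].

Fixpoint bitstrings (n : nat) : seq (seq bool) :=
  if n is m.+1 then
    [seq false :: s | s <- bitstrings m] ++ [seq true :: s | s <- bitstrings m]
  else [:: [::]].

(* [bitstrings k] is in lexicographic order, so the concatenation below lists
   the strings of [tree Q] of length at most [n] by length, then
   lexicographically.  For nonempty [Q] every level of [tree Q] is nonempty, so
   there are more than [n] of them and the default value is not used. *)
Definition tree_enum (Q : set cantor_space) (n : nat) : seq bool :=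
  nth [::]
    (flatten [seq [seq s <- bitstrings k | `[< tree Q s >]] | k <- iota 0 n.+1])
    n.

Definition ternary_space : Type :=
  prod_topology (fun _ : nat => discrete_topology 'I_3).

HB.instance Definition _ := Choice.on ternary_space.
HB.instance Definition _ := isPointed.Build ternary_space (fun=> ord0).
HB.instance Definition _ := Nbhs.on ternary_space.
HB.instance Definition _ := Topological.on ternary_space.

Definition code_closed (Q : set cantor_space) : ternary_space :=
  fun n =>
    let s := tree_enum Q n in
    if `[< tree Q (rcons s false) /\ tree Q (rcons s true) >] then inord 2
    else if `[< tree Q (rcons s true) >] then inord 1 else inord 0.

Definition ternary_borel := g_sigma_algebraType (@open ternary_space).

Definition is_mu_of (R : realType) (d : seq 'I_3 -> R)
    (mu : probability ternary_borel R) : Prop :=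
  forall s : seq 'I_3, mu (cylinder s) = (d s)%:E.

Definition mu_star (R : realType) (mu : probability ternary_borel R)
    (X : set (set cantor_space)) : \bar R :=
  mu (code_closed @` X).

Definition hitting_capacity (R : realType) (mu : probability ternary_borel R)
    (Q : set cantor_space) : \bar R :=
  mu_star mu [set K | hyperspace K /\ K `&` Q !=set0].

(* Main.v *)
(* A finite string s of digits decides an initial part of the tree of K: it says
   that K avoids a clopen set D_s and meets each cylinder in the finite set F_s
   of nodes whose children are still undecided.  Inclusion-exclusion forces the
   weight
     d(s) = \sum_(J \subset F_s) (-1)^(#|J|+1) T(D_s \cup \bigcup J),
   which is nonnegative because T is alternating, is computable because T is
   computable on clopen sets, and is additive because the next digit splits a
   node f of F_s into its two children.  Adding a clopen set B to D_s in the
   formula gives another additive weight; once s is long enough for B to be a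
   union of decided pieces, it is d(s) or 0 according as the sets coded by the
   extensions of s all avoid B or all meet B.  Its value at the empty string,
   1 - T(B), is therefore the probability of avoiding B.  Compactness and
   continuity from above extend this from clopen to closed sets. *)

Require Import Defs.
From mathcomp Require Import all_boot all_order all_algebra.
From mathcomp Require Import all_classical all_reals all_analysis.
From mathcomp Require Import ring lra zify.
Import Order.TTheory GRing.Theory Num.Theory numFieldNormedType.Exports.

Set Implicit Arguments.
Unset Strict Implicit.
Unset Printing Implicit Defensive.

Local Open Scope classical_set_scope.
Local Open Scope ring_scope.

(** * Recursive functions *)

Section RecursiveFunctions.
Local Open Scope nat_scope.

(** The weight is given at once by a formula in [T], not digit by digit through conditional
    probabilities: no quotient of weights occurs, and strings of weight zero, which a computation
    could not recognize, need no separate case. The price is a number of terms exponential in the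
    length of the queue; since the code of a digit string bounds this length, the precision asked of
    each term can be read off the code. The undecided nodes form a first-in-first-out queue. Serving
    it meets the nodes of the tree in the very order used by [code_closed], so digit strings can be
    processed without knowing the set they code. Every digit leaves the queue nonempty, hence every
    ternary sequence codes exactly one nonempty closed set, and images of families of closed sets
    become conditions on sequences. The measure is obtained as the law of the digits of a uniform
    random number in [0, 1]. *)

Lemma eq_recursive k (f g : k.-tuple nat -> nat) :
  f =1 g -> recursive f -> recursive g.
Proof. by move=> /funext ->. Qed.

Lemma recursive_const k c : recursive (fun _ : k.-tuple nat => c).
Proof.
elim: c => [|c IHc]; first exact: recursive_zero.
apply: eq_recursive (recursive_comp recursive_succ (fun _ : 'I_1 => IHc)).
by move=> x; rewrite tnth_mktuple.
Qed.

(* Out of bounds projections are constantly 0. *)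
Lemma recursive_nth k i : recursive (fun x : k.-tuple nat => nth 0 x i).
Proof.
have [ik|ki] := ltnP i k.
  apply: eq_recursive (recursive_proj (Ordinal ik)) => x.
  by rewrite (tnth_nth 0).
apply: eq_recursive (recursive_const k 0) => x.
by rewrite nth_default ?size_tuple.
Qed.

Lemma recursive_comp1 k (g : nat -> nat) (a : k.-tuple nat -> nat) :
  recursive (fun x : 1.-tuple nat => g (nth 0 x 0)) -> recursive a ->
  recursive (fun x => g (a x)).
Proof.
move=> hg ha; apply: eq_recursive (recursive_comp hg (fun _ : 'I_1 => ha)) => x.
by rewrite -[X in nth 0 _ X]/(nat_of_ord (@ord0 0)) -tnth_nth tnth_mktuple.
Qed.

Lemma recursive_comp2 k (g : nat -> nat -> nat) (a b : k.-tuple nat -> nat) :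
  recursive (fun x : 2.-tuple nat => g (nth 0 x 0) (nth 0 x 1)) ->
  recursive a -> recursive b -> recursive (fun x => g (a x) (b x)).
Proof.
move=> hg ha hb.
have hab (i : 'I_2) : recursive (if i == 0 :> nat then a else b) by case: ifP.
apply: eq_recursive (recursive_comp hg hab) => x.
rewrite -[X in g (nth 0 _ X)]/(nat_of_ord (@ord0 1)).
by rewrite -[1]/(nat_of_ord (@ord_max 1)) -!tnth_nth !tnth_mktuple.
Qed.

Lemma mktuple_nth k (x : k.-tuple nat) : [tuple nth 0 x i | i < k] = x.
Proof. by apply: eq_from_tnth => i; rewrite tnth_mktuple -tnth_nth. Qed.

(** Form of primitive recursion used for all loops below: bound, initial value and step may all
    depend on the parameters [x], whereas [recursive_prim] wants the counter as first entry of the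
    tuple. *)
Lemma recursive_nat_rect k (a b : k.-tuple nat -> nat)
    (g : nat -> nat -> k.-tuple nat -> nat) :
  recursive a -> recursive b ->
  recursive (fun y : k.+2.-tuple nat =>
    g (nth 0 y 0) (nth 0 y 1) [tuple nth 0 y i.+2 | i < k]) ->
  recursive (fun x => nat_rect _ (b x) (fun n z => g n z x) (a x)).
Proof.
move=> ha hb hg.
pose h (y : k.+1.-tuple nat) :=
  let x := [tuple nth 0 y i.+1 | i < k] in
  nat_rect (fun _ => nat) (b x) (fun n z => g n z x) (nth 0 y 0).
have hh : recursive h.
  apply: (recursive_prim hb hg) => [x|n x]; first by rewrite /h /= mktuple_nth.
  by rewrite /h /= !mktuple_nth.
pose A (i : 'I_k.+1) (x : k.-tuple nat) :=
  if i == 0 :> nat then a x else nth 0 x i.-1.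
have hA i : recursive (A i).
  by rewrite /A; case: eqP => // _; exact: recursive_nth.
apply: eq_recursive (recursive_comp hh hA) => x; rewrite /h.
have -> : nth 0 [tuple A i x | i < k.+1] 0 = a x.
  by rewrite -[0 in X in nth _ _ X]/(nat_of_ord (@ord0 k)) -tnth_nth tnth_mktuple.
suff -> : [tuple nth 0 [tuple A i x | i < k.+1] j.+1 | j < k] = x by [].
rewrite -[RHS]mktuple_nth; apply: eq_mktuple => i.
have -> : i.+1 = lift ord0 i :> nat by [].
by rewrite -tnth_nth tnth_mktuple.
Qed.

Lemma recursive_iter k (g : nat -> nat) (a b : k.-tuple nat -> nat) :
  recursive (fun x : 1.-tuple nat => g (nth 0 x 0)) ->
  recursive a -> recursive b -> recursive (fun x => iter (a x) g (b x)).
Proof.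
move=> hg ha hb.
apply: (@eq_recursive _ (fun x => nat_rect _ (b x) (fun n z => g z) (a x))).
  by move=> x; elim: (a x) => //= n ->.
apply: (recursive_nat_rect (g := fun _ z _ => g z)) => //.
apply: recursive_comp1 => //; exact: recursive_nth.
Qed.

Lemma recursive_S k (a : k.-tuple nat -> nat) :
  recursive a -> recursive (fun x => (a x).+1).
Proof.
apply: recursive_comp1; apply: eq_recursive recursive_succ => x.
by rewrite (tnth_nth 0).
Qed.

Lemma recursive_add k (a b : k.-tuple nat -> nat) :
  recursive a -> recursive b -> recursive (fun x => a x + b x).
Proof.
move=> ha hb; apply: (@eq_recursive _ (fun x => iter (a x) succn (b x))).
  by move=> x; rewrite iter_succn addnC.
apply: recursive_iter => //; apply: recursive_S; exact: recursive_nth.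
Qed.

Lemma recursive_mul k (a b : k.-tuple nat -> nat) :
  recursive a -> recursive b -> recursive (fun x => a x * b x).
Proof.
apply: (@recursive_comp2 _ muln).
apply: (@eq_recursive _ (fun x : 2.-tuple nat =>
  nat_rect _ 0 (fun _ z => z + nth 0 x 1) (nth 0 x 0))).
  by move=> x; elim: (nth 0 x 0) => //= n ->; rewrite mulSn addnC.
apply: (recursive_nat_rect (g := fun _ z x => z + nth 0 x 1)).
- exact: recursive_nth.
- exact: recursive_const.
apply: recursive_add; first exact: recursive_nth.
apply: eq_recursive (recursive_nth _ 3) => x.
by rewrite -[X in _ = nth 0 _ X]/(nat_of_ord (@ord_max 1)) -tnth_nth tnth_mktuple.
Qed.

Lemma recursive_pred k (a : k.-tuple nat -> nat) :
  recursive a -> recursive (fun x => (a x).-1).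
Proof.
move=> ha.
apply: (@eq_recursive _ (fun x => nat_rect (fun _ => nat) 0 (fun n _ => n) (a x))).
  by move=> x; case: (a x).
apply: (recursive_nat_rect (g := fun n _ _ => n)) => //.
  exact: recursive_const.
exact: recursive_nth.
Qed.

Lemma recursive_sub k (a b : k.-tuple nat -> nat) :
  recursive a -> recursive b -> recursive (fun x => a x - b x).
Proof.
move=> ha hb; apply: (@eq_recursive _ (fun x => iter (b x) predn (a x))).
  by move=> x; rewrite iter_predn.
apply: recursive_iter => //; apply: recursive_pred; exact: recursive_nth.
Qed.

Lemma recursive_exp2 k (a : k.-tuple nat -> nat) :
  recursive a -> recursive (fun x => 2 ^ a x).
Proof.
move=> ha; apply: (@eq_recursive _ (fun x => iter (a x) double 1)).
  by move=> x; elim: (a x) => //= n ->; rewrite expnS mul2n.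
apply: recursive_iter => //; last exact: recursive_const.
apply: (@eq_recursive _ (fun x => nth 0 x 0 + nth 0 x 0)).
  by move=> x; rewrite addnn.
by apply: recursive_add; exact: recursive_nth.
Qed.

Lemma recursive_eq0 k (a : k.-tuple nat -> nat) :
  recursive a -> recursive (fun x => nat_of_bool (a x == 0)).
Proof.
move=> ha; apply: (@eq_recursive _ (fun x => 1 - a x)).
  by move=> x; case: (a x).
by apply: recursive_sub => //; exact: recursive_const.
Qed.

Lemma recursive_odd k (a : k.-tuple nat -> nat) :
  recursive a -> recursive (fun x => nat_of_bool (odd (a x))).
Proof.
move=> ha.
apply: (@eq_recursive _ (fun x => iter (a x) (fun z => nat_of_bool (z == 0)) 0)).
  by move=> x; elim: (a x) => //= n ->; case: odd.
apply: recursive_iter => //; last exact: recursive_const.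
apply: recursive_eq0; exact: recursive_nth.
Qed.

Lemma recursive_if k (b : k.-tuple nat -> bool) (u v : k.-tuple nat -> nat) :
  recursive (fun x => nat_of_bool (b x)) -> recursive u -> recursive v ->
  recursive (fun x => if b x then u x else v x).
Proof.
move=> hb hu hv.
apply: (@eq_recursive _ (fun x => b x * u x + (1 - b x) * v x)).
  by move=> x; case: (b x); rewrite ?mul1n ?mul0n ?addn0.
apply: recursive_add; apply: recursive_mul => //.
by apply: recursive_sub => //; exact: recursive_const.
Qed.

Lemma recursive_half k (a : k.-tuple nat -> nat) :
  recursive a -> recursive (fun x => (a x)./2).
Proof.
move=> ha.
apply: (@eq_recursive _ (fun x => nat_rect _ 0 (fun n z => z + odd n) (a x))).
  move=> x; elim: (a x) => //= n ->.
  by rewrite uphalf_half addnC.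
apply: (recursive_nat_rect (g := fun n z _ => z + odd n)) => //.
  exact: recursive_const.
apply: recursive_add; last apply: recursive_odd; exact: recursive_nth.
Qed.

(** The quotient is the least [y] such that [u] is below the product of [y.+1] and [v.+1]. A
    successor as divisor guarantees that such a [y] always exists, as total minimization demands. *)
Lemma recursive_divS k (a b : k.-tuple nat -> nat) :
  recursive a -> recursive b -> recursive (fun x => a x %/ (b x).+1).
Proof.
apply: (@recursive_comp2 _ (fun u v => u %/ v.+1)).
pose test (y : 3.-tuple nat) := (nth 0 y 1).+1 - (nth 0 y 0).+1 * (nth 0 y 2).+1.
apply: (@recursive_min _ test).
  apply: recursive_sub; first by apply: recursive_S; exact: recursive_nth.
  by apply: recursive_mul; apply: recursive_S; exact: recursive_nth.
move=> x; rewrite /test /=; set u := nth 0 x 0; set v := nth 0 x 1.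
split=> [|y]; first by apply/eqP; rewrite subn_eq0 ltn_ceil.
rewrite leq_divRL // => yu /eqP; rewrite subn_eq0 => uy.
by have := leq_ltn_trans yu uy; rewrite ltnn.
Qed.

End RecursiveFunctions.

(** * Computable functions on coded data *)

Section CodedFunctions.
Local Open Scope nat_scope.

(* The code of [a :: s] is [code_pair a (CodeSeq.code s)]. *)
Definition code_pair (a b : nat) := 2 ^ a * b.*2.+1.
Definition code_fst (c : nat) := logn 2 c.
Definition code_snd (c : nat) := (c %/ 2 ^ code_fst c)./2.

Lemma code_fstK a b : code_fst (code_pair a b) = a.
Proof.
rewrite /code_fst /code_pair lognM ?expn_gt0 // pfactorK // lognE /=.
by rewrite dvdn2 /= odd_double addn0.
Qed.

Lemma code_sndK a b : code_snd (code_pair a b) = b.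
Proof.
by rewrite /code_snd code_fstK /code_pair mulKn ?expn_gt0 //= uphalf_double.
Qed.

Lemma recursive_code_pair k (a b : k.-tuple nat -> nat) :
  recursive a -> recursive b -> recursive (fun x => code_pair (a x) (b x)).
Proof.
move=> ha hb; apply: recursive_mul; first exact: recursive_exp2.
apply: recursive_S; apply: eq_recursive (recursive_add hb hb) => x.
by rewrite addnn.
Qed.

Lemma iter_half n c : iter n half c = c %/ 2 ^ n.
Proof.
elim: n => [|n IHn]; first by rewrite divn1.
by rewrite iterS IHn -divn2 -divnMA expnSr.
Qed.

Lemma recursive_code_fst k (a : k.-tuple nat -> nat) :
  recursive a -> recursive (fun x => code_fst (a x)).
Proof.
apply: recursive_comp1.
(* The search looks for the least [y] with [c %/ 2 ^ y] odd. For [c = 0] there is none, so the test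
   succeeds at once, in agreement with [logn 2 0 = 0]. *)
pose test (y : 2.-tuple nat) := if nth 0 y 1 == 0 then 0
  else nat_of_bool (nat_of_bool (odd (iter (nth 0 y 0) half (nth 0 y 1))) == 0).
apply: (@recursive_min _ test).
  apply: recursive_if; first by apply: recursive_eq0; exact: recursive_nth.
    exact: recursive_const.
  apply: recursive_eq0; apply: recursive_odd.
  apply: recursive_iter; [|exact: recursive_nth..].
  by apply: recursive_half; exact: recursive_nth.
move=> x; rewrite /test /= /code_fst; set c := nth 0 x 0.
case: eqP => [->|/eqP]; first by rewrite logn0.
rewrite -lt0n => c0; have [m cm cE] := pfactor_coprime (isT : prime 2) c0.
move: cm; rewrite coprime2n => cm; rewrite cE lognM ?expn_gt0 //; last by case: m cm {cE}.
rewrite pfactorK // [logn 2 m]lognE dvdn2 cm andbF /= add0n.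
set l := logn 2 c; rewrite iter_half mulnK ?expn_gt0 // cm; split=> // y yl.
rewrite iter_half -(subnK (ltnW yl)) expnD mulnA mulnK ?expn_gt0 //.
by rewrite oddM oddX subn_eq0 leqNgt yl andbF.
Qed.

Lemma recursive_code_snd k (a : k.-tuple nat -> nat) :
  recursive a -> recursive (fun x => code_snd (a x)).
Proof.
move=> ha; apply: recursive_half.
apply: (@eq_recursive _ (fun x => a x %/ (2 ^ code_fst (a x)).-1.+1)).
  by move=> x; rewrite prednK ?expn_gt0.
apply: recursive_divS => //; apply: recursive_pred; apply: recursive_exp2.
exact: recursive_code_fst.
Qed.

Definition prod_code X Y (cX : X -> nat) (cY : Y -> nat) (p : X * Y) :=
  code_pair (cX p.1) (cY p.2).

Definition seq_code X (cX : X -> nat) (s : seq X) := CodeSeq.code (map cX s).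

(** [f] is tracked on codes. The values of [g] outside the range of [cX] are free, so no recognition
    of valid codes is ever required. *)
Definition computes X Y (cX : X -> nat) (cY : Y -> nat) (f : X -> Y) :=
  exists2 g : nat -> nat, recursive (fun x : 1.-tuple nat => g (nth 0 x 0)) &
    forall x, g (cX x) = cY (f x).

Section Combinators.
Variables (X Y Z : Type).
Variables (cX : X -> nat) (cY : Y -> nat) (cZ : Z -> nat).

Lemma eq_computes (f g : X -> Y) :
  f =1 g -> computes cX cY f -> computes cX cY g.
Proof. by move=> /funext ->. Qed.

Lemma computes_comp (f : X -> Y) (g : Y -> Z) :
  computes cX cY f -> computes cY cZ g -> computes cX cZ (g \o f).
Proof.
move=> [u hu uE] [v hv vE]; exists (v \o u); first exact: (recursive_comp1 hv hu).
by move=> x /=; rewrite uE vE.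
Qed.

Lemma computes_id : computes cX cX id.
Proof. by exists id => //; exact: recursive_nth. Qed.

Lemma computes_const (y : Y) : computes cX cY (fun=> y).
Proof. by exists (fun=> cY y) => //; exact: recursive_const. Qed.

Lemma computes_fst (f : X -> Y * Z) :
  computes cX (prod_code cY cZ) f -> computes cX cY (fun x => (f x).1).
Proof.
move=> [u hu uE]; exists (code_fst \o u); first exact: recursive_code_fst.
by move=> x /=; rewrite uE code_fstK.
Qed.

Lemma computes_snd (f : X -> Y * Z) :
  computes cX (prod_code cY cZ) f -> computes cX cZ (fun x => (f x).2).
Proof.
move=> [u hu uE]; exists (code_snd \o u); first exact: recursive_code_snd.
by move=> x /=; rewrite uE code_sndK.
Qed.

Lemma computes_pair (f : X -> Y) (g : X -> Z) :
  computes cX cY f -> computes cX cZ g ->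
  computes cX (prod_code cY cZ) (fun x => (f x, g x)).
Proof.
move=> [u hu uE] [v hv vE]; exists (fun n => code_pair (u n) (v n)).
  exact: recursive_code_pair.
by move=> x; rewrite uE vE.
Qed.

Lemma computes_cons (f : X -> Y) (g : X -> seq Y) :
  computes cX cY f -> computes cX (seq_code cY) g ->
  computes cX (seq_code cY) (fun x => f x :: g x).
Proof.
move=> [u hu uE] [v hv vE]; exists (fun n => code_pair (u n) (v n)).
  exact: recursive_code_pair.
by move=> x; rewrite uE vE.
Qed.

Lemma computes_if (b : X -> bool) (f g : X -> Y) :
  computes cX nat_of_bool b -> computes cX cY f -> computes cX cY g ->
  computes cX cY (fun x => if b x then f x else g x).
Proof.
move=> [t ht tE] [u hu uE] [v hv vE].
exists (fun n => if t n == 0 then v n else u n).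
  apply: recursive_if => //; exact: recursive_eq0.
by move=> x; rewrite tE uE vE; case: (b x).
Qed.

End Combinators.

(** The empty list has code 0 and [code_fst 0 = 0], whence the condition on the code of the default
    value. *)
Lemma computes_head X Y (cX : X -> nat) (cY : Y -> nat) y0 (f : X -> seq Y) :
  cY y0 = 0 -> computes cX (seq_code cY) f ->
  computes cX cY (fun x => head y0 (f x)).
Proof.
move=> y00 [u hu uE]; exists (code_fst \o u); first exact: recursive_code_fst.
move=> x /=; rewrite uE; case: (f x) => [|y s] /=; last exact: code_fstK.
by rewrite y00 /code_fst logn0.
Qed.

Lemma computes_behead X Y (cX : X -> nat) (cY : Y -> nat) (f : X -> seq Y) :
  computes cX (seq_code cY) f -> computes cX (seq_code cY) (fun x => behead (f x)).
Proof.
move=> [u hu uE]; exists (code_snd \o u); first exact: recursive_code_snd.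
by move=> x /=; rewrite uE; case: (f x) => //= y s; exact: code_sndK.
Qed.

(** Bounds the length of a loop over a list by the code of the list, and later the length of a queue
    by the code of the digit string. *)
Lemma size_code s : size s <= CodeSeq.code s.
Proof.
elim: s => //= n s IHs; apply: leq_trans (leq_pmull _ (expn_gt0 2 n)).
by rewrite ltnS; apply: leq_trans IHs _; rewrite -addnn leq_addr.
Qed.

(** The loop is iterated as many times as the code of the list, hence at least its length. A step
    leaves an exhausted list unchanged, so the surplus iterations do no harm. *)
Lemma computes_foldl X Y Z (cX : X -> nat) (cY : Y -> nat) (cZ : Z -> nat)
    (F : X -> Z -> Y -> Z) (z : X -> Z) (s : X -> seq Y) :
  computes (prod_code cX (prod_code cZ cY)) cZ (fun p => F p.1 p.2.1 p.2.2) ->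
  computes cX cZ z -> computes cX (seq_code cY) s ->
  computes cX cZ (fun x => foldl (F x) (z x) (s x)).
Proof.
move=> [u hu uE] [v hv vE] [w hw wE].
(* One step of the loop on the code of [(x, (z, s))]. *)
pose step c := if code_snd (code_snd c) == 0 then c else
  code_pair (code_fst c) (code_pair
    (u (code_pair (code_fst c) (code_pair (code_fst (code_snd c))
      (code_fst (code_snd (code_snd c))))))
    (code_snd (code_snd (code_snd c)))).
exists (fun n =>
  code_fst (code_snd (iter (w n) step (code_pair n (code_pair (v n) (w n)))))).
  have hn k i : recursive (fun x : k.-tuple nat => nth 0 x i) by exact: recursive_nth.
  apply/recursive_code_fst/recursive_code_snd/recursive_iter => //; last first.
    by do 2?apply: recursive_code_pair.
  have h1 := recursive_code_snd (hn 1 0).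
  have h2 := recursive_code_snd h1; have h3 := recursive_code_snd h2.
  apply: recursive_if => //; first exact: recursive_eq0.
  apply: recursive_code_pair; first exact: recursive_code_fst.
  apply: recursive_code_pair => //; apply: recursive_comp1 hu _.
  by do 2?[apply: recursive_code_pair]; apply: recursive_code_fst.
move=> x; rewrite vE wE.
have step0 y : step (code_pair (cX x) (code_pair (cZ y) 0))
    = code_pair (cX x) (code_pair (cZ y) 0) by rewrite /step !code_sndK.
have stepS y a t :
    step (code_pair (cX x) (code_pair (cZ y) (code_pair (cY a) t)))
    = code_pair (cX x) (code_pair (cZ (F x y a)) t).
  rewrite /step !(code_sndK, code_fstK) muln_eq0 expn_eq0 /=.
  by rewrite (uE (x, (y, a))).
have iterE n t y : size t <= n ->
    iter n step (code_pair (cX x) (code_pair (cZ y) (seq_code cY t)))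
    = code_pair (cX x) (code_pair (cZ (foldl (F x) y t)) 0).
  elim: n t y => [|n IHn] [|a t] y // tn; rewrite iterSr.
    by rewrite step0 (IHn [::]).
  by rewrite stepS IHn.
rewrite iterE ?code_sndK ?code_fstK //.
by apply: leq_trans (size_code _); rewrite size_map.
Qed.

Lemma computes_cat X Y (cX : X -> nat) (cY : Y -> nat) (f g : X -> seq Y) :
  computes cX (seq_code cY) f -> computes cX (seq_code cY) g ->
  computes cX (seq_code cY) (fun x => f x ++ g x).
Proof.
move=> hf hg.
pose push (_ : X) (s : seq Y) a := a :: s.
have hpush : computes (prod_code cX (prod_code (seq_code cY) cY)) (seq_code cY)
    (fun p => push p.1 p.2.1 p.2.2).
  have := computes_id (prod_code cX (prod_code (seq_code cY) cY)).
  move=> /computes_snd h; apply: computes_cons.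
    exact: computes_snd h.
  exact: computes_fst h.
have revE (s t : seq Y) x : foldl (push x) t s = rev s ++ t.
  by elim: s t => //= a s IHs t; rewrite IHs rev_cons cat_rcons.
apply: (@eq_computes _ _ _ _ (fun x => foldl (push x) (g x) (foldl (push x) [::] (f x)))).
  by move=> x; rewrite !revE cats0 revK.
by apply: (computes_foldl hpush) => //; apply: (computes_foldl hpush) => //;
  exact: computes_const.
Qed.

End CodedFunctions.

(** * Weights of digit strings *)

Definition kids (i : 'I_3) (f : seq bool) : seq (seq bool) :=
  if i == 0%N :> nat then [:: rcons f false] else
  if i == 1%N :> nat then [:: rcons f true] else
  [:: rcons f false; rcons f true].

Definition drops (i : 'I_3) (f : seq bool) : seq (seq bool) :=
  if i == 0%N :> nat then [:: rcons f true] else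
  if i == 1%N :> nat then [:: rcons f false] else [::].

(* A state is a pair: strings known to be off the tree, and the queue of the
   strings known to be on the tree whose children are still undetermined.
   Breadth first, the head of the queue is the next string of the tree in the
   order by length then lexicographic. *)
Definition state_step (st : seq (seq bool) * seq (seq bool)) (i : 'I_3) :=
  (drops i (head [::] st.2) ++ st.1, behead st.2 ++ kids i (head [::] st.2)).

Definition state (s : seq 'I_3) := foldl state_step ([::], [:: [::]]) s.
Definition dead s := (state s).1.
Definition queue s := (state s).2.

(** * Inclusion-exclusion sums and their lists of terms *)

Section Difference.
Variables (R : realType) (T : set cantor_space -> R).

(* For nonempty [F], the probability that a random closed set avoids [D] and
   meets all of [F]. *)
Fixpoint difference (D : set cantor_space) (F : seq (set cantor_space)) : R :=
  if F is f :: F' then difference D F' - difference (D `|` f) F' else - T D.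

(** [difference] ends in [- T D] instead of the avoidance probability [1 - T D]: the queue is never
    empty, so the ones cancel in the alternating sum. *)
Definition weight s :=
  difference (clopen_of (dead s)) [seq cylinder f : set cantor_space | f <- queue s].

Lemma clopen_of_cons f L : clopen_of (f :: L) = clopen_of L `|` cylinder f.
Proof.
apply/seteqP; split=> x /=.
  move=> [s]; rewrite inE => /orP[/eqP ->|sL] xs; first by right.
  by left; exists s.
by move=> [[s sL xs]|xf]; [exists s; rewrite // inE sL orbT|exists f; rewrite // mem_head].
Qed.

Lemma clopen_of_nil : clopen_of [::] = set0.
Proof. by apply/seteqP; split=> x // [s]. Qed.

(** A left fold with an accumulator, the shape handled by [computes_foldl]. *)
Definition addall (f : seq bool) (L acc : seq (seq (seq bool))) :=
  foldl (fun z l => (f :: l) :: z) acc L.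

Lemma sum_addall (g : seq (seq bool) -> R) f L acc :
  \sum_(l <- addall f L acc) g l = \sum_(l <- acc) g l + \sum_(l <- L) g (f :: l).
Proof.
elim: L acc => [|l L IHL] acc /=; first by rewrite big_nil addr0.
by rewrite IHL !big_cons; ring.
Qed.

Lemma size_addall f L acc : size (addall f L acc) = (size L + size acc)%N.
Proof. by elim: L acc => //= l L IHL acc; rewrite IHL /= addnS. Qed.

(** One unfolding of [difference]: each list stays with its sign and its extension by [f] gets the
    opposite sign. Two lists of terms replace signed values, which have no direct code in [nat]. *)
Definition terms_step (st : seq (seq (seq bool)) * seq (seq (seq bool)))
    (f : seq bool) :=
  (addall f st.2 st.1, addall f st.1 st.2).

(* The arguments of the positive and of the negative terms of [difference]. *)
Definition terms D F := foldl terms_step ([::], [:: D]) F.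

Lemma difference_terms D F :
  difference (clopen_of D) [seq cylinder f : set cantor_space | f <- F] =
  \sum_(L <- (terms D F).1) T (clopen_of L) - \sum_(L <- (terms D F).2) T (clopen_of L).
Proof.
(* Loop invariant, with [G] the strings still to be processed. The second list counts positively
   here; the value [- T D] of the empty difference reverses the signs at the end. *)
pose val st (G : seq (seq bool)) :=
  \sum_(L <- st.2) difference (clopen_of L) [seq cylinder f : set cantor_space | f <- G]
  - \sum_(L <- st.1) difference (clopen_of L) [seq cylinder f : set cantor_space | f <- G].
have valE st G : val st G = val (foldl terms_step st G) [::].
  elim: G st => [|f G IHG] st //=; rewrite -IHG /val /= !sum_addall !sumrB.
  pose h L := difference (clopen_of L) [seq cylinder g : set cantor_space | g <- G].
  have consE A : \sum_(L <- A) h (f :: L) = \sum_(L <- A) difference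
      (clopen_of L `|` cylinder f) [seq cylinder g : set cantor_space | g <- G].
    by apply: eq_bigr => L _; rewrite /h clopen_of_cons.
  by rewrite /h in consE; rewrite !consE; ring.
have := valE ([::], [:: D]) F; rewrite {1}/val big_nil big_seq1 subr0 => ->.
by rewrite /val /= !sumrN opprK addrC.
Qed.

Lemma size_terms D F :
  (size (terms D F).1 + size (terms D F).2 = 2 ^ size F)%N.
Proof.
suff sz st : (size (foldl terms_step st F).1 + size (foldl terms_step st F).2
    = (size st.1 + size st.2) * 2 ^ size F)%N by rewrite sz mul1n.
elim: F st => [|f F IHF] st /=; first by rewrite muln1.
by rewrite IHF /= !size_addall expnS; lia.
Qed.

End Difference.

(** A digit removes one string and appends at most two. *)
Lemma size_queue s : (size (queue s) <= (size s).+1)%N.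
Proof.
rewrite /queue; elim/last_ind: s => //= s i IHs.
rewrite /state foldl_rcons -/(state s) size_cat size_behead size_rcons /=.
by move: IHs; case: (state s).2 => //= [|a F]; rewrite /kids; do 2?case: ifP => _ //=; lia.
Qed.

(** * Computability of the weights *)

Section Computability.

Lemma computes_rcons X (cX : X -> nat) (f : X -> seq bool) b :
  computes cX code_bitstring f -> computes cX code_bitstring (fun x => rcons (f x) b).
Proof.
move=> hf; apply: (@eq_computes _ _ _ _ (fun x => f x ++ [:: b])) => [x|].
  by rewrite cats1.
by apply: (@computes_cat _ _ _ nat_of_bool) => //; exact: computes_const.
Qed.

Lemma computes_eqn X (cX : X -> nat) (f : X -> 'I_3) n :
  computes cX (@nat_of_ord 3) f -> computes cX nat_of_bool (fun x => f x == n :> nat).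
Proof.
move=> [u hu uE]; exists (fun c => nat_of_bool ((u c - n) + (n - u c) == 0)%N).
  have hc : recursive (fun _ : 1.-tuple nat => n) by exact: recursive_const.
  by apply: recursive_eq0; apply: recursive_add; apply: recursive_sub.
by move=> x; rewrite uE addn_eq0 !subn_eq0 -eqn_leq.
Qed.

Lemma computes_state : computes code_tritstring
  (prod_code code_bitstrings code_bitstrings) state.
Proof.
pose cB := prod_code code_bitstrings code_bitstrings.
pose c1 := prod_code code_tritstring (prod_code cB (@nat_of_ord 3)).
apply: (@computes_foldl _ _ _ code_tritstring (@nat_of_ord 3) cB
  (fun=> state_step) (fun=> ([::], [:: [::]])) id).
- have h2 : computes c1 (prod_code cB (@nat_of_ord 3)) snd.
    exact: (computes_snd (computes_id c1)).
  have hst := computes_fst h2; have hi := computes_snd h2.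
  have hD := computes_fst hst; have hF := computes_snd hst.
  have hf : computes c1 code_bitstring (fun x => head [::] x.2.1.2).
    exact: computes_head.
  have hnil : computes c1 code_bitstrings (fun=> [::]) by exact: computes_const.
  have h0 := computes_rcons false hf; have h1 := computes_rcons true hf.
  have hs (g : _ -> seq bool) : computes c1 code_bitstring g ->
      computes c1 code_bitstrings (fun x => [:: g x]).
    by move=> hg; exact: (computes_cons hg hnil).
  have hi0 := computes_eqn 0 hi; have hi1 := computes_eqn 1 hi.
  apply: computes_pair; apply: (@computes_cat _ _ _ code_bitstring) => //.
  + apply: computes_if => //; first exact: hs.
    by apply: computes_if => //; exact: hs.
  + exact: computes_behead.
  + apply: computes_if => //; first exact: hs.
    apply: computes_if => //; first exact: hs.
    exact: (computes_cons h0 (hs _ h1)).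
- exact: computes_const.
- exact: computes_id.
Qed.

Lemma computes_terms X (cX : X -> nat) (D F : X -> seq (seq bool)) :
  computes cX code_bitstrings D -> computes cX code_bitstrings F ->
  computes cX (prod_code (seq_code code_bitstrings) (seq_code code_bitstrings))
    (fun x => terms (D x) (F x)).
Proof.
set cP := seq_code code_bitstrings => hD hF.
have hadd Y (cY : Y -> nat) (f : Y -> seq bool) (A B : Y -> seq (seq (seq bool))) :
    computes cY code_bitstring f -> computes cY cP A -> computes cY cP B ->
    computes cY cP (fun y => addall (f y) (A y) (B y)).
  move=> hf hA hB.
  apply: (computes_foldl (F := fun y z l => (f y :: l) :: z)) hA => //.
  have h := computes_id (prod_code cY (prod_code cP code_bitstrings)).
  have h2 := computes_snd h.
  apply: computes_cons; last exact: computes_fst h2.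
  apply: computes_cons; last exact: computes_snd h2.
  exact: (computes_comp (computes_fst h) hf).
apply: (computes_foldl (F := fun _ => terms_step)) hF.
  have h := computes_snd (computes_id (prod_code cX (prod_code (prod_code cP cP) code_bitstring))).
  have hA := computes_fst h; have hf := computes_snd h.
  by apply: computes_pair; apply: hadd => //; [exact: computes_snd hA|
   exact: computes_fst hA|exact: computes_fst hA|exact: computes_snd hA].
apply: computes_pair; first exact: computes_const.
by apply: computes_cons => //; exact: computes_const.
Qed.

Lemma computes_nat2 X (cX : X -> nat) (G : nat -> nat -> nat) (f g : X -> nat) :
  recursive (fun x : 2.-tuple nat => G (nth 0%N x 0) (nth 0%N x 1)) ->
  computes cX id f -> computes cX id g -> computes cX id (fun x => G (f x) (g x)).
Proof.
move=> hG [u hu uE] [v hv vE]; exists (fun c => G (u c) (v c)).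
  exact: recursive_comp2.
by move=> x; rewrite uE vE.
Qed.

Lemma recursive_binary (p : 2.-tuple nat -> nat) : recursive p ->
  recursive (fun x : 2.-tuple nat => p [tuple nth 0%N x 0; nth 0%N x 1]).
Proof.
apply: eq_recursive => x; congr p; apply: val_inj.
by case: x => [[|a [|b []]]].
Qed.

Lemma computes_binary X (cX : X -> nat) (f : X * nat -> nat) :
  computes (prod_code cX id) id f ->
  exists2 p, recursive p & forall x n, p [tuple cX x; n] = f (x, n).
Proof.
move=> [u hu uE]; exists (fun x => u (code_pair (nth 0%N x 0) (nth 0%N x 1))).
  apply: recursive_comp1 hu _; apply: recursive_code_pair; exact: recursive_nth.
by move=> x n; rewrite -[RHS](uE (x, n)).
Qed.

(** Replaces a signed fraction by a natural number over [2 ^ m], so that approximations can be added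
    in [nat]. Truncated subtraction clips the fraction at 0, which brings it no farther from
    [t >= 0]; rounding down costs the second [2 ^- m]. *)
Lemma dyadic_floor (R : realType) (t : R) (p q r m : nat) : 0 <= t ->
  `|t - (p%:R - q%:R) / r.+1%:R| <= 2 ^- m ->
  `|t - (((p - q) * 2 ^ m) %/ r.+1)%:R / 2 ^+ m| <= 2 * 2 ^- m.
Proof.
move=> t0 tpq; set k := (_ %/ _)%N.
have r0 : 0 < r.+1%:R :> R by rewrite ltr0n.
have m0 : 0 < 2 ^+ m :> R by rewrite exprn_gt0.
have kle : k%:R * r.+1%:R <= (p - q)%:R * 2 ^+ m :> R.
  by rewrite -natrX -!natrM ler_nat leq_divM.
have kgt : (p - q)%:R * 2 ^+ m < (k%:R + 1) * r.+1%:R :> R.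
  by rewrite natr1 -natrX -!natrM ltr_nat ltn_ceil.
have {}kle : k%:R / 2 ^+ m <= (p - q)%:R / r.+1%:R :> R.
  by rewrite ler_pdivrMr // mulrAC ler_pdivlMr.
have {}kgt : (p - q)%:R / r.+1%:R < k%:R / 2 ^+ m + 2 ^- m :> R.
  by rewrite -[X in _ + X]mul1r -mulrDl ltr_pdivrMr // mulrAC ltr_pdivlMr.
have em : 0 < 2 ^- m :> R by rewrite invr_gt0.
have bound v k' e : 0 <= e -> `|t - v| <= e -> k' <= Num.max 0 v ->
    Num.max 0 v < k' + e -> `|t - k'| <= 2 * e.
  by rewrite !ler_norml /Num.max; case: ifP => ? ? /andP[? ?] ? ?; apply/andP; split; lra.
have maxE : (p - q)%:R / r.+1%:R = Num.max 0 ((p%:R - q%:R) / r.+1%:R) :> R.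
  have [qp|pq] := leqP q p.
    by rewrite natrB // max_r // divr_ge0 // subr_ge0 ler_nat.
  have -> : (p - q = 0)%N by apply/eqP; rewrite subn_eq0 ltnW.
  by rewrite mul0r max_l // pmulr_lle0 ?invr_gt0 // subr_le0 ler_nat ltnW.
by apply: bound tpq _ _; rewrite -?maxE // ltW.
Qed.

Lemma dist_sum (R : realType) (I : Type) (s : seq I) (f g : I -> R) (e : R) :
  (forall i, `|f i - g i| <= e) ->
  `|\sum_(i <- s) f i - \sum_(i <- s) g i| <= (size s)%:R * e.
Proof.
move=> fg; rewrite -sumrB; apply: le_trans (ler_norm_sum _ _ _) _.
by rewrite mulr_natl -iter_addr_0 -count_predT -big_const_seq ler_sum.
Qed.

Lemma computable_weight (R : realType) (T : set cantor_space -> R) :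
  computable_real_fun code_bitstrings (fun L => T (clopen_of L)) ->
  (forall L, 0 <= T (clopen_of L)) ->
  computable_real_fun code_tritstring (weight T).
Proof.
move=> [p [q [r [hp hq hr approxT]]]] T_ge0.
pose a c m := (((p [tuple c; m] - q [tuple c; m]) * 2 ^ m) %/ (r [tuple c; m]).+1)%N.
have ha : recursive (fun x : 2.-tuple nat => a (nth 0%N x 0) (nth 0%N x 1)).
  apply: recursive_divS; last exact: recursive_binary.
  apply: recursive_mul; last by apply: recursive_exp2; exact: recursive_nth.
  by apply: recursive_sub; exact: recursive_binary.
pose cX := prod_code code_tritstring id.
(* Let [c] be the code of the string. There are at most [2 ^ (c + 1)] terms, each with error at most
   [2 * 2 ^- m]; the precision [m = n + c + 2] brings the total down to [2 ^- n]. *)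
pose prec (x : seq 'I_3 * nat) := (x.2 + code_tritstring x.1 + 2)%N.
have hprec : computes cX id prec.
  exists (fun c => (code_snd c + code_fst c + 2)%N).
    apply: recursive_add; last exact: recursive_const.
    by apply: recursive_add; [apply: recursive_code_snd|apply: recursive_code_fst];
      exact: recursive_nth.
  by move=> x; rewrite code_fstK code_sndK.
have hsum (A : seq 'I_3 * nat -> seq (seq (seq bool))) :
    computes cX (seq_code code_bitstrings) A ->
    computes cX id (fun x => foldl (fun z L => (z + a (code_bitstrings L) (prec x))%N) 0%N (A x)).
  move=> hA; apply: (computes_foldl (F := fun x z L => (z + a (code_bitstrings L) (prec x))%N)) hA.
    set c1 := prod_code _ _; have h := computes_id c1; have h2 := computes_snd h.
    apply: (computes_nat2 (G := addn)).
    - by apply: recursive_add; exact: recursive_nth.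
    - exact: (computes_fst h2).
    apply: computes_nat2 ha _ _; last exact: (computes_comp (computes_fst h) hprec).
    exact: (computes_snd h2).
  exact: computes_const.
have sumE m A z : foldl (fun z L => (z + a (code_bitstrings L) m)%N) z A
    = (z + \sum_(L <- A) a (code_bitstrings L) m)%N.
  elim: A z => [|L A IHA] z /=; first by rewrite big_nil addn0.
  by rewrite IHA big_cons addnA.
have hstate : computes cX (prod_code code_bitstrings code_bitstrings) (fun x => state x.1).
  exact: (computes_comp (computes_fst (computes_id cX)) computes_state).
have hterms := computes_terms (computes_fst hstate) (computes_snd hstate).
have [p' hp' p'E] := computes_binary (hsum _ (computes_fst hterms)).
have [q' hq' q'E] := computes_binary (hsum _ (computes_snd hterms)).
have [r' hr' r'E] : exists2 r', recursive r' &
    forall x n, r' [tuple code_tritstring x; n] = (2 ^ prec (x, n)).-1.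
  apply: (@computes_binary _ _ (fun x => (2 ^ prec x).-1)).
  have [u hu uE] := hprec; exists (fun c => (2 ^ u c).-1); last by move=> x; rewrite uE.
  by apply: recursive_pred; exact: recursive_exp2.
exists p', q', r'; split=> // s n; rewrite p'E q'E r'E prednK ?expn_gt0 //= !sumE !add0n natrX.
rewrite /weight difference_terms -/(dead s) -/(queue s).
set A := terms _ _; set m := prec _.
have dist (B : seq (seq (seq bool))) : `|\sum_(L <- B) T (clopen_of L)
    - (\sum_(L <- B) a (code_bitstrings L) m)%N%:R / 2 ^+ m| <= (size B)%:R * (2 * 2 ^- m).
  rewrite natr_sum mulr_suml; apply: dist_sum => L.
  exact: dyadic_floor.
have szA : (size A.1)%:R + (size A.2)%:R <= 2 ^+ (m - n - 1) :> R.
  rewrite -natrD size_terms -natrX ler_nat leq_exp2l //.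
  rewrite /m /prec; apply: leq_trans (size_queue s) _.
  have := size_code [seq nat_of_ord i | i <- s]; rewrite size_map -/(code_tritstring s).
  by move=> /=; lia.
have -> : 2 ^- n = 2 ^+ (m - n - 1) * (2 * 2 ^- m) :> R.
  rewrite -{2}(@subnK n.+1 m); last by rewrite /m /prec /=; lia.
  rewrite exprD exprS -subnDA addn1; set u := 2 ^+ (m - n.+1).
  have u0 : u != 0 by rewrite expf_neq0.
  have v0 : 2 ^+ n != 0 :> R by rewrite expf_neq0.
  by field; rewrite u0 v0.
have e0 : 0 <= 2 * 2 ^- m :> R by rewrite mulr_ge0 // invr_ge0 exprn_ge0.
apply: le_trans (ler_wpM2r e0 szA).
rewrite [leRHS]mulrDl; apply: le_trans (lerD (dist A.1) (dist A.2)).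
by rewrite [X in `|X|](_ : _ = (\sum_(L <- A.1) T (clopen_of L)
    - (\sum_(L <- A.1) a (code_bitstrings L) m)%N%:R / 2 ^+ m) -
   (\sum_(L <- A.2) T (clopen_of L)
    - (\sum_(L <- A.2) a (code_bitstrings L) m)%N%:R / 2 ^+ m)) ?ler_normB //; ring.
Qed.

End Computability.
(** * Cylinders and compactness *)

Section Cylinders.
Variable A : Type.
Implicit Types (x : nat -> A) (s : seq A).

Lemma cylinder_rcons s a x :
  cylinder (rcons s a) x <-> cylinder s x /\ x (size s) = a.
Proof.
rewrite /cylinder /= size_rcons mkseqS; split; last by move=> [-> ->].
by move=> /rcons_inj [-> ->].
Qed.

Lemma cylinder_mkseq x n : cylinder (mkseq x n) x.
Proof. by rewrite /cylinder /= size_mkseq. Qed.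

Lemma cylinder_mkseqP x y n : cylinder (mkseq x n) y <-> mkseq y n = mkseq x n.
Proof. by rewrite /cylinder /= size_mkseq. Qed.

Lemma mkseq_take x m n : (m <= n)%N -> take m (mkseq x n) = mkseq x m.
Proof. by move=> mn; rewrite /mkseq -map_take take_iota (minn_idPl mn). Qed.

Lemma eq_mkseq_le x y m n : (m <= n)%N ->
  mkseq x n = mkseq y n -> mkseq x m = mkseq y m.
Proof. by move=> mn e; rewrite -(mkseq_take x mn) e mkseq_take. Qed.

Lemma cylinder_mkseq_le x m n : (m <= n)%N ->
  cylinder (mkseq x n) `<=` cylinder (mkseq x m).
Proof. by move=> mn y /cylinder_mkseqP /(eq_mkseq_le mn) ?; apply/cylinder_mkseqP. Qed.

End Cylinders.

Section CylinderTopology.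
Variable A : discreteTopologicalType.
Local Notation space := (prod_topology (fun _ : nat => A)).

Lemma coord_clopen n (a : A) :
  open ([set x | x n = a] : set space) /\ closed ([set x | x n = a] : set space).
Proof.
have -> : [set x : space | x n = a] = proj n @^-1` [set a] by [].
split; [apply: open_comp; last exact: discrete_open|
        apply: closed_comp; last exact: discrete_closed];
  by move=> x _; exact: proj_continuous.
Qed.

Lemma cylinder_clopen (s : seq A) :
  open (cylinder s : set space) /\ closed (cylinder s : set space).
Proof.
elim/last_ind: s => [|s a [IHo IHc]].
  have -> : cylinder [::] = [set: space] by apply/seteqP; split.
  by split; [exact: openT|exact: closedT].
have -> : cylinder (rcons s a) = cylinder s `&` [set x : space | x (size s) = a].
  by apply/seteqP; split=> x /cylinder_rcons.
have [ho hc] := coord_clopen (size s) a.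
by split; [exact: openI|exact: closedI].
Qed.

(** The sets containing a cylinder about [x] form a filter. Its convergence to [x] is tested on each
    coordinate [i], which a cylinder of length [i.+1] fixes. *)
Lemma cylinder_basis (U : set space) (x : space) :
  open U -> U x -> exists n, cylinder (mkseq x n) `<=` U.
Proof.
move=> oU Ux; pose G : set_system space := [set B | exists n, cylinder (mkseq x n) `<=` B].
have FG : Filter G.
  split.
  - by exists 0%N.
  - move=> P Q [m mP] [n nQ]; exists (maxn m n) => y hy; split.
      by apply: mP; apply: cylinder_mkseq_le hy; exact: leq_maxl.
    by apply: nQ; apply: cylinder_mkseq_le hy; exact: leq_maxr.
  - by move=> P Q PQ [n nP]; exists n; exact: subset_trans nP PQ.
suff Gx : G --> x by apply: Gx; exact: open_nbhs_nbhs.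
apply/cvg_sup => i B; rewrite nbhsE => -[C [[D oD DC] Cx] CB].
exists i.+1 => y /cylinder_mkseqP; rewrite !mkseqS => /rcons_inj [_ yx].
by apply: CB; move: Cx; rewrite -DC /= yx.
Qed.

Lemma closed_cylinderP (K : set space) (x : space) : closed K ->
  (forall n, K `&` cylinder (mkseq x n) !=set0) -> K x.
Proof.
move=> cK hK; apply: contrapT => nKx.
have [n hn] := cylinder_basis (closed_openC cK) nKx.
by have [y [Ky /hn]] := hK n.
Qed.

End CylinderTopology.

Lemma compact_nested (T : topologicalType) (C : nat -> set T) :
  compact [set: T] -> (forall n, closed (C n)) -> (forall n, C n !=set0) ->
  (forall n, C n.+1 `<=` C n) -> \bigcap_n C n !=set0.
Proof.
move=> cT cC C0 Cdecr.
have Cle m n : (m <= n)%N -> C n `<=` C m.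
  elim: n => [|n IHn]; first by rewrite leqn0 => /eqP ->.
  rewrite leq_eqVlt => /orP[/eqP -> //|/IHn h]; exact: subset_trans (Cdecr n) h.
pose F : set_system T := [set B | exists n, C n `<=` B].
have FF : ProperFilter F.
  split; first by move=> [n Cn]; have [x /Cn] := C0 n.
  split.
  - by exists 0%N.
  - move=> P Q [m mP] [n nQ]; exists (maxn m n) => y hy; split.
      by apply: mP; apply: Cle hy; exact: leq_maxl.
    by apply: nQ; apply: Cle hy; exact: leq_maxr.
  - by move=> P Q PQ [n nP]; exists n; exact: subset_trans nP PQ.
have [p [_ clp]] := cT F FF (ex_intro _ 0%N (fun _ _ => I)).
exists p => n _; apply: cC => B nB.
by apply: clp nB; exists n.
Qed.

(** * The coding of closed sets *)

Section Queue.

Definition queue_step (F : seq (seq bool)) (i : 'I_3) :=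
  behead F ++ kids i (head [::] F).

Lemma state_rcons s i : state (rcons s i) = state_step (state s) i.
Proof. by rewrite /state foldl_rcons. Qed.

Lemma queue_rcons s i : queue (rcons s i) = queue_step (queue s) i.
Proof. by rewrite /queue state_rcons. Qed.

Lemma dead_rcons s i : dead (rcons s i) = drops i (head [::] (queue s)) ++ dead s.
Proof. by rewrite /dead state_rcons. Qed.

Lemma queue_cat s w : queue (s ++ w) = foldl queue_step (queue s) w.
Proof.
elim/last_ind: w => [|w i IHw]; first by rewrite cats0.
by rewrite -rcons_cat queue_rcons IHw foldl_rcons.
Qed.

Lemma ord3_cases (P : 'I_3 -> Prop) :
  P (inord 0) -> P (inord 1) -> P (inord 2) -> forall i, P i.
Proof.
move=> p0 p1 p2 [[|[|[|//]]] i3].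
- by rewrite (_ : Ordinal i3 = inord 0) //; apply: val_inj; rewrite /= inordK.
- by rewrite (_ : Ordinal i3 = inord 1) //; apply: val_inj; rewrite /= inordK.
- by rewrite (_ : Ordinal i3 = inord 2) //; apply: val_inj; rewrite /= inordK.
Qed.

Lemma kidsE f :
  (kids (inord 0) f = [:: rcons f false]) *
  (kids (inord 1) f = [:: rcons f true]) *
  (kids (inord 2) f = [:: rcons f false; rcons f true]) *
  (drops (inord 0) f = [:: rcons f true]) *
  (drops (inord 1) f = [:: rcons f false]) *
  (drops (inord 2) f = [::]).
Proof. by rewrite /kids /drops !inordK. Qed.

Lemma queue_step_neq0 F i : queue_step F i != [::].
Proof.
move: i; rewrite /queue_step.
by apply: ord3_cases; rewrite kidsE; case: F => [|f [|g F]].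
Qed.

Lemma queue_neq0 s : queue s != [::].
Proof. by elim/last_ind: s => // s i _; rewrite queue_rcons queue_step_neq0. Qed.

Lemma queue_head_behead s : queue s = head [::] (queue s) :: behead (queue s).
Proof. by have := queue_neq0 s; case: (queue s). Qed.

(** The dead strings and the queue partition Cantor space: a digit replaces the head of the queue by
    its two children, shared out between [drops] and [kids]. Counting gives covering and
    disjointness together. *)
Lemma prefix_count (y : nat -> bool) s :
  count (fun f => mkseq y (size f) == f) (dead s ++ queue s) = 1%N.
Proof.
pose P (f : seq bool) := mkseq y (size f) == f.
change (count P (dead s ++ queue s) = 1%N).
elim/last_ind: s => [//|s i IHs].
rewrite queue_rcons dead_rcons; rewrite queue_head_behead in IHs.
move: IHs; rewrite /queue_step !count_cat /=.
set f := head _ _ => IHs.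
suff : (count P (drops i f) + count P (kids i f) = P f)%N by lia.
rewrite /P; move: i; apply: ord3_cases; rewrite !kidsE /= !size_rcons !mkseqS !eqseq_rcons;
  by case: eqP => //= _; case: (y _).
Qed.

Lemma clopen_of_dead s : clopen_of (dead s) = ~` clopen_of (queue s).
Proof.
have clopen_has L (y : cantor_space) :
    clopen_of L y <-> has (fun f => mkseq y (size f) == f) L.
  split; first by move=> [f fL /eqP yf]; apply/hasP; exists f.
  by move=> /hasP[f fL /eqP yf]; exists f.
apply/seteqP; split=> y /=; rewrite !clopen_has !has_count;
  by have := prefix_count y s; rewrite count_cat => *; lia.
Qed.

Lemma queue_step_depth k F1 F2 w : F1 ++ F2 != [::] ->
  all (fun f => k <= size f)%N F1 -> all (fun f => k < size f)%N F2 ->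
  (size F1 <= size w)%N ->
  all (fun f => k < size f)%N (foldl queue_step (F1 ++ F2) w).
Proof.
have kids_all i f : (k <= size f)%N -> all (fun g => k < size g)%N (kids i f).
  by move=> kf; move: i; apply: ord3_cases; rewrite kidsE /= !size_rcons !ltnS kf.
elim: w F1 F2 => [|i w IHw] [|f F1] F2 //= F0.
  move=> _ aF2 _; apply: (IHw [::] _ (queue_step_neq0 _ _)) => //=.
  case: F2 F0 aF2 => //= f F2 _ /andP[kf aF2].
  by rewrite all_cat aF2 kids_all // ltnW.
move=> /andP[kf aF1] aF2 sz; rewrite /queue_step /= -catA.
apply: IHw => //; last by rewrite all_cat aF2 kids_all.
by have := queue_step_neq0 (f :: F1 ++ F2) i; rewrite /queue_step /= catA.
Qed.

Lemma queue_depth k : exists N, forall s, (N <= size s)%N ->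
  all (fun f => k <= size f)%N (queue s).
Proof.
elim: k => [|k [N IHN]]; first by exists 0%N => s _; exact/allP.
(* After [N] digits the queue has at most [N.+1] strings, and [N.+1] further digits serve each of
   them. *)
exists (N + N.+1)%N => s sN.
have szN : size (take N s) = N by rewrite size_takel //; lia.
rewrite -(cat_take_drop N s) queue_cat -[queue _]cats0.
apply: queue_step_depth => //; first by rewrite cats0 queue_neq0.
  by apply: IHN; rewrite szN.
by apply: leq_trans (size_queue _) _; rewrite szN size_drop; lia.
Qed.

End Queue.

(** * From digit sequences to closed sets *)

Section ClosedOf.

Lemma string_cylinder (f : seq bool) : cylinder f (nth false f).
Proof. exact: mkseq_nth. Qed.

Lemma cylinder_cantor_clopen (s : seq bool) :
  open (cylinder s : set cantor_space) /\ closed (cylinder s : set cantor_space).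
Proof. exact: cylinder_clopen. Qed.

Lemma clopen_of_clopen L : open (clopen_of L) /\ closed (clopen_of L).
Proof.
elim: L => [|f L [IHo IHc]].
  by rewrite clopen_of_nil; split; [exact: open0|exact: closed0].
have [fo fc] := cylinder_cantor_clopen f.
by rewrite clopen_of_cons; split; [exact: openU|exact: closedU].
Qed.

Lemma kids_sub i f g : g \in kids i f -> cylinder g `<=` cylinder f.
Proof.
move: i; apply: ord3_cases; rewrite kidsE !inE;
  by move=> h; repeat (move: h => /orP[] h || idtac); move: h => /eqP-> y /cylinder_rcons[].
Qed.

Lemma clopen_of_queue_sub s i :
  clopen_of (queue (rcons s i)) `<=` clopen_of (queue s).
Proof.
move=> y [g]; rewrite queue_rcons mem_cat => /orP[gF|/kids_sub gy] yg.
  by exists g => //; rewrite queue_head_behead inE gF orbT.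
by exists (head [::] (queue s)); [rewrite {2}queue_head_behead mem_head|exact: gy].
Qed.

Lemma clopen_of_queue_decr (x : nat -> 'I_3) m n :
  clopen_of (queue (mkseq x (m + n))) `<=` clopen_of (queue (mkseq x n)).
Proof.
elim: m => // m IHm; rewrite addSn mkseqS.
exact: subset_trans (@clopen_of_queue_sub _ _) IHm.
Qed.

(* The inverse of [code_closed] on nonempty closed sets. *)
Definition closed_of (x : nat -> 'I_3) : set cantor_space :=
  \bigcap_n clopen_of (queue (mkseq x n)).

Lemma closed_closed_of x : closed (closed_of x).
Proof. by apply: closed_bigI => n _; have [] := clopen_of_clopen (queue (mkseq x n)). Qed.

Lemma queue_descendant (x : nat -> 'I_3) m n f : f \in queue (mkseq x n) ->
  exists2 g, g \in queue (mkseq x (m + n)) & cylinder g `<=` cylinder f.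
Proof.
move=> fq; elim: m => [|m [g gq gf]]; first by exists f.
move: gq; rewrite addSn mkseqS queue_rcons {1}queue_head_behead inE.
set h := head _ _; move=> /orP[/eqP gh|gq]; last first.
  by exists g => //; rewrite mem_cat gq.
have [g' g'k] : exists g', g' \in kids (x (m + n)%N) h.
  by move: (x _); apply: ord3_cases; rewrite kidsE; exists (rcons h false) + exists (rcons h true);
    rewrite mem_head.
exists g'; first by rewrite mem_cat g'k orbT.
by rewrite gh in gf; exact: subset_trans (kids_sub g'k) gf.
Qed.

(** No digit kills both children, so [f] has a descendant on every later queue; compactness then
    yields a point of [cylinder f] covered by all queues. *)
Lemma closed_of_meets x n f : f \in queue (mkseq x n) ->
  closed_of x `&` cylinder f !=set0.
Proof.
move=> fq.
pose C m : set cantor_space := clopen_of (queue (mkseq x (m + n))) `&` cylinder f.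
have [||m|m|y hy] := @compact_nested cantor_space C.
- exact: cantor_space_compact.
- move=> m; apply: closedI; last by have [] := cylinder_cantor_clopen f.
  by have [] := clopen_of_clopen (queue (mkseq x (m + n))).
- have [g gq gf] := queue_descendant m fq.
  by exists (nth false g : cantor_space); split; [exists g => //|apply: gf]; exact: string_cylinder.
- apply: setSI; rewrite -[(m.+1 + n)%N]/(1 + (m + n))%N; exact: clopen_of_queue_decr.
exists y; split; last by have [] := hy 0%N I.
move=> m _; have [] := hy m I; rewrite addnC => + _; exact: clopen_of_queue_decr.
Qed.

End ClosedOf.

(** * The queue follows the enumeration of the tree *)

Section Enumeration.
Variable K : set cantor_space.

Definition level k := [seq s <- bitstrings k | `[< tree K s >]].

Definition children f := [seq t <- [:: rcons f false; rcons f true] | `[< tree K t >]].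

(** [bitstrings] branches on the first bit, the queue on the last one; both produce the
    lexicographic order. *)
Lemma bitstringsS k : bitstrings k.+1 =
  flatten [seq [:: rcons s false; rcons s true] | s <- bitstrings k].
Proof.
elim: k => // k IHk.
rewrite {1}/bitstrings -/(bitstrings k.+1) {1 2}IHk [in RHS]/bitstrings -/(bitstrings k).
by rewrite map_cat flatten_cat !map_flatten -!map_comp.
Qed.

Lemma mem_bitstrings s k : (s \in bitstrings k) = (size s == k).
Proof.
elim: k s => [|k IHk] s; first by rewrite inE size_eq0.
rewrite mem_cat; case: s => [|b s].
  by apply/orP => -[] /mapP[].
apply/orP/eqP => [[] /mapP[t + [_ ->]]|[sk]]; rewrite ?IHk ?eqSS.
- by move=> /eqP <-.
- by move=> /eqP <-.
by case: b; [right|left]; apply: map_f; rewrite IHk sk.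
Qed.

Lemma tree_rcons s b : tree K (rcons s b) -> tree K s.
Proof. by move=> [y [Ky /cylinder_rcons[ys _]]]; exists y. Qed.

Lemma tree_kid s : tree K s -> tree K (rcons s false) \/ tree K (rcons s true).
Proof.
move=> [y [Ky ys]]; case yE : (y (size s)); [right|left];
  by exists y; split => //; apply/cylinder_rcons.
Qed.

Lemma children_notin s : ~ tree K s -> children s = [::].
Proof.
move=> ns; rewrite /children /=.
by do 2?[case: asboolP => [/tree_rcons //|_]].
Qed.

Lemma levelS k : level k.+1 = flatten [seq children s | s <- level k].
Proof.
rewrite /level bitstringsS filter_flatten -map_comp.
elim: (bitstrings k) => //= s L ->.
have [Ks|/children_notin] := asboolP (tree K s); first by [].
by rewrite /children /= => ->.
Qed.

Definition digit f : 'I_3 :=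
  if `[< tree K (rcons f false) /\ tree K (rcons f true) >] then inord 2
  else if `[< tree K (rcons f true) >] then inord 1 else inord 0.

Lemma code_closed_digit n : code_closed K n = digit (tree_enum K n).
Proof. by []. Qed.

Lemma kids_digit f : tree K f -> kids (digit f) f = children f.
Proof.
move=> /tree_kid fk; rewrite /digit /children /=.
case: asboolP => [[f0 f1]|nf].
  by rewrite kidsE (asboolT f0) (asboolT f1).
case: asboolP => f1.
  by rewrite kidsE asboolF // => f0; exact: nf.
by rewrite kidsE asboolT //; case: fk.
Qed.

Hypothesis K0 : K !=set0.

Lemma level_neq0 k : level k != [::].
Proof.
have [y Ky] := K0; apply/eqP => lk.
have : mkseq y k \in level k.
  rewrite mem_filter mem_bitstrings size_mkseq eqxx andbT; apply/asboolP.
  by exists y; split=> //; exact: cylinder_mkseq.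
by rewrite lk.
Qed.

(* The queue holds the rest [B] of level [k], followed by the children of the
   part [A] of that level that has been processed. *)
Definition queue_at n F := exists k A B,
  [/\ level k = A ++ B, B != [::], F = B ++ flatten [seq children f | f <- A] &
      n = (size (flatten [seq level j | j <- iota 0 k]) + size A)%N].

Lemma queue_at0 : queue_at 0 [:: [::]].
Proof.
exists 0%N, [::], [:: [::]]; split=> //; rewrite /level /= asboolT //.
by have [y Ky] := K0; exists y.
Qed.

Lemma queue_at_head n F : queue_at n F -> head [::] F = tree_enum K n.
Proof.
move=> [k [A [B [lk B0 -> nE]]]].
(* [tree_enum] lists only the levels up to [n]; level [k] is among them because each earlier level
   contributes at least one string. *)
have kn : (k <= n)%N.
  rewrite nE; apply: leq_trans (leq_addr _ _); elim: (k) => // j IHj.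
  rewrite -[in iota _ _](addn1 j) iotaD map_cat flatten_cat size_cat /= cats0 -addn1.
  by apply: leq_add => //; rewrite lt0n size_eq0 level_neq0.
rewrite /tree_enum -(subnKC (leqW kn)) subSn // iotaD map_cat flatten_cat /=.
rewrite -/(level _) nth_cat ifN; last by rewrite -leqNgt nE leq_addr.
rewrite add0n lk -catA nth_cat ifN; last by rewrite nE addKn ltnn.
rewrite -subnDA -nE subnn; by case: B B0 {lk nE} => //.
Qed.

Lemma queue_atS n F : queue_at n F -> queue_at n.+1 (queue_step F (code_closed K n)).
Proof.
move=> Fn; rewrite code_closed_digit -(queue_at_head Fn).
move: Fn => [k [A [[|f B] [lk // _ -> nE]]]] /=.
have Kf : tree K f.
  have : f \in level k by rewrite lk mem_cat mem_head orbT.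
  by rewrite mem_filter => /andP[/asboolP].
rewrite /queue_step /= kids_digit //.
(* When the last string of level [k] has been served, the queue is exactly level [k.+1], and the
   description restarts there. *)
have [B0|B0] := eqVneq B [::].
  rewrite {}B0 in lk *.
  exists k.+1, [::], (level k.+1); split; rewrite ?level_neq0 //.
    by rewrite levelS lk map_cat flatten_cat /= !cats0.
  rewrite -[in iota _ _](addn1 k) iotaD map_cat flatten_cat size_cat /= cats0 nE add0n.
  by rewrite lk size_cat addn0 addn1 addnS.
exists k, (rcons A f), B; split=> //.
- by rewrite cat_rcons.
- by rewrite map_rcons flatten_rcons catA.
- by rewrite size_rcons nE addnS.
Qed.

Lemma queue_code n : queue_at n (queue (mkseq (code_closed K) n)).
Proof.
elim: n => [|n IHn]; first exact: queue_at0.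
by rewrite mkseqS queue_rcons; exact: queue_atS.
Qed.

Lemma queue_at_tree n F f : queue_at n F -> f \in F -> tree K f.
Proof.
move=> [k [A [B [lk _ -> _]]]]; rewrite mem_cat => /orP[fB|].
  have : f \in level k by rewrite lk mem_cat fB orbT.
  by rewrite mem_filter => /andP[/asboolP].
by move=> /flattenP[_ /mapP[g _ ->]]; rewrite mem_filter => /andP[/asboolP].
Qed.

Lemma queue_at_cover n F : queue_at n F -> K `<=` clopen_of F.
Proof.
move=> [k [A [B [lk _ -> _]]]] y Ky.
have Ty m : tree K (mkseq y m) by exists y; split=> //; exact: cylinder_mkseq.
have : mkseq y k \in level k.
  by rewrite mem_filter mem_bitstrings size_mkseq eqxx andbT; exact/asboolP.
rewrite lk mem_cat => /orP[yA|yB].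
  exists (mkseq y k.+1); last exact: cylinder_mkseq.
  rewrite mem_cat; apply/orP; right; apply/flattenP; exists (children (mkseq y k)).
    exact: map_f.
  rewrite mem_filter asboolT // mkseqS.
  by case: (y k); rewrite !inE eqxx ?orbT.
exists (mkseq y k); last exact: cylinder_mkseq.
by rewrite mem_cat yB.
Qed.

End Enumeration.

(** Every queue covers [K], and its strings all meet [K] while becoming arbitrarily long, so a point
    covered by all queues is a limit of points of [K]. *)
Lemma closed_of_code K : closed K -> K !=set0 -> closed_of (code_closed K) = K.
Proof.
move=> cK K0; apply/seteqP; split=> y; last first.
  by move=> Ky n _; exact: queue_at_cover (queue_code K0 n) _ Ky.
move=> yx; apply: closed_cylinderP => // k.
have [N depthN] := queue_depth k.
have [f fq yf] := yx N I.
have := allP (depthN _ _) f fq; rewrite size_mkseq leqnn => /(_ isT) kf.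
have [z [Kz zf]] := queue_at_tree (queue_code K0 N) fq.
exists z; split=> //; apply/cylinder_mkseqP; apply: eq_mkseq_le kf _.
by rewrite zf.
Qed.

Lemma closed_of_neq0 x : closed_of x !=set0.
Proof.
have [y [Ky _]] := @closed_of_meets x 0 [::] isT.
by exists y.
Qed.

(** Equal prefixes give equal queues, hence the same next node. Its [kids] meet the set and its
    [drops] do not, which determines the next digit. *)
Lemma code_closed_of x : code_closed (closed_of x) = x.
Proof.
set K := closed_of x; have K0 : K !=set0 by exact: closed_of_neq0.
suff eqx n : mkseq (code_closed K) n = mkseq x n.
  apply: funext => n; have := eqx n.+1.
  by rewrite !mkseqS => /rcons_inj[].
elim: n => // n IHn; rewrite !mkseqS IHn; congr rcons.
have Fn := queue_code K0 n; rewrite code_closed_digit -(queue_at_head K0 Fn) IHn.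
set f := head _ _.
have kidT g : g \in kids (x n) f -> tree K g.
  move=> gk; apply: (@closed_of_meets x n.+1).
  by rewrite mkseqS queue_rcons mem_cat gk orbT.
have dropF g : g \in drops (x n) f -> ~ tree K g.
  move=> gd [y [Ky yg]].
  have : clopen_of (dead (mkseq x n.+1)) y.
    by exists g => //; rewrite mkseqS dead_rcons mem_cat gd.
  by rewrite clopen_of_dead; apply; exact: Ky.
rewrite /digit; move: (x n) kidT dropF; apply: ord3_cases; rewrite kidsE => kidT dropF.
- have F1 : ~ tree K (rcons f true) by apply: dropF; rewrite kidsE mem_head.
  by rewrite asboolF ?asboolF // => -[].
- have F0 : ~ tree K (rcons f false) by apply: dropF; rewrite kidsE mem_head.
  by rewrite asboolF ?asboolT // => [|[]//]; apply: kidT; rewrite mem_head.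
- by rewrite asboolT //; split; apply: kidT; rewrite !inE eqxx ?orbT.
Qed.

(** * Positivity and additivity *)

Section DifferenceTheory.
Variables (R : realType) (T : set cantor_space -> R).
Implicit Types (D f : set cantor_space) (F G : seq (set cantor_space)).

(** Order is irrelevant to [difference]; this is needed because a digit takes a string from the
    front of the queue and puts its children at the back. *)
Lemma difference_cat_cons D f F G :
  difference T D (F ++ f :: G) = difference T D (f :: F ++ G).
Proof.
elim: F D => // g F IHF D; rewrite cat_cons [LHS]/= !IHF /=.
by rewrite (setUAC D g f); ring.
Qed.

Lemma difference_subset D f F : f `<=` D -> difference T D (f :: F) = 0.
Proof. by move=> fD; rewrite /= setUidl // subrr. Qed.

(** A set that meets a union of two sets meets only the first, only the second, or both: one term
    for each digit. *)
Lemma difference_split D f0 f1 F :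
  difference T D (f0 `|` f1 :: F) =
  difference T (D `|` f1) (f0 :: F) + difference T (D `|` f0) (f1 :: F)
  + difference T D [:: f0, f1 & F].
Proof. by rewrite /= -!setUA (setUC f1 f0); ring. Qed.

(** Links the recursion to the sums over subsets in the alternating condition: subsets of [a :: s]
    are sorted by whether they contain [a]. *)
Lemma difference_expand (I : finType) (Q : I -> set cantor_space) D (s : seq I) :
  uniq s -> difference T D [seq Q i | i <- s] =
  \sum_(J : {set I} | J \subset s)
    (-1) ^+ #|J|.+1 * T (D `|` \bigcup_(i in [set i | i \in J]) Q i).
Proof.
elim: s D => [|a s IHs] D /=.
  rewrite (big_pred1 finset.set0) => [_|J].
    rewrite cards0 expr1 mulN1r (_ : D `|` _ = D) //.
    by apply/seteqP; split=> [x [//|[i /=]]|x]; [rewrite inE|left].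
  apply/idP/eqP => [/fintype.subsetP J0|->]; last by apply/fintype.subsetP => i; rewrite inE.
  by apply/setP => i; rewrite inE; apply/negP => /J0.
move=> /andP[as_ us]; rewrite !IHs // [RHS](bigID (fun J : {set I} => a \in J)) /= [RHS]addrC.
congr (_ + _).
  apply: eq_bigl => J; apply/idP/andP => [/fintype.subsetP Js|[/fintype.subsetP Js aJ]].
    split; first by apply/fintype.subsetP => i /Js is_; rewrite inE is_ orbT.
    by apply/negP => /Js; rewrite (negPf as_).
  apply/fintype.subsetP => i iJ; have := Js i iJ; rewrite inE => /orP[/eqP ia|//].
  by rewrite -ia iJ in aJ.
rewrite -sumrN [RHS](reindex_onto (fun J : {set I} => a |: J)%SET
  (fun J => J :\ a)%SET) /=; last first.
  by move=> J /andP[_ aJ]; rewrite finset.setD1K.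
apply: eq_big => [J|J Js].
  apply/idP/andP => [/fintype.subsetP Js|[/andP[/fintype.subsetP Js _] /eqP aJ]].
    have aJ : a \notin J by apply/negP => /Js; rewrite (negPf as_).
    rewrite finset.setU1K // eqxx finset.setU11 andbT; split=> //; apply/fintype.subsetP => i.
    by rewrite !inE => /orP[->//|/Js ->]; rewrite orbT.
  apply/fintype.subsetP => i iJ; have /Js : i \in (a |: J)%SET by rewrite inE iJ orbT.
  rewrite inE => /orP[/eqP ia|//].
  by move: iJ; rewrite -aJ ia !inE eqxx.
have aJ : a \notin J by apply/negP => /(fintype.subsetP Js); rewrite (negPf as_).
rewrite cardsU1 aJ -mulNr; congr (_ * T _); first by rewrite add1n !exprS; ring.
rewrite -setUA; congr (_ `|` _); apply/seteqP; split=> x.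
  by move=> [Qx|[i /= iJ Qx]]; [exists a|exists i]; rewrite //= !inE ?eqxx ?iJ ?orbT.
by move=> [i /=]; rewrite !inE => /orP[/eqP -> Qx|iJ Qx]; [left|right; exists i].
Qed.

(** The alternating inequality is applied to the unions of [D] with the members of [F], whose
    intersection contains [D]; the empty subset contributes [- T D]. That inequality starts at two
    sets, so a single one is settled by monotonicity. *)
Lemma difference_ge0 D F : is_capacity T -> closed D ->
  (forall f, f \in F -> closed f) -> F != [::] -> 0 <= difference T D F.
Proof.
move=> [_ _ T_mono T_alt _] cD cF.
have cDf f : f \in F -> closed (D `|` f) by move=> /cF; exact: closedU.
case: F cF cDf => [|f [|g F']] // cF cDf _.
  rewrite /= opprK addrC subr_ge0; apply: T_mono; first exact: cD.
    by apply: cDf; rewrite mem_head.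
  by move=> x Dx; left.
move: cF cDf; set F := [:: f, g & F'] => cF cDf.
pose Q (i : 'I_(size F)) := nth set0 F i.
have -> : F = [seq Q i | i <- enum 'I_(size F)].
  by rewrite -[LHS](@mkseq_nth _ set0) /mkseq -val_enum_ord -map_comp.
rewrite difference_expand ?enum_uniq // (bigD1 finset.set0) /=;
  last by apply/fintype.subsetP => i; rewrite inE.
rewrite cards0 expr1 mulN1r addrC subr_ge0.
rewrite (_ : D `|` _ = D); last first.
  by apply/seteqP; split=> [x [//|[i /=]]|x]; [rewrite inE|left].
have QF i : Q i \in F by apply: mem_nth.
have := T_alt (size F) (fun i => D `|` Q i) isT (fun i => cDf _ (QF i)).
move=> alt; apply: le_trans (le_trans alt _).
  apply: T_mono => //; last by move=> x Dx i _; left.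
  by apply: closed_bigI => i _; exact: cDf.
rewrite le_eqVlt; apply/orP; left; apply/eqP.
apply: eq_big => [J|J J0].
  by rewrite (_ : J \subset _) //; apply/fintype.subsetP => i _; rewrite mem_enum.
congr (_ * T _); apply/seteqP; split=> x.
  by move=> [i iJ [Dx|Qx]]; [left|right; exists i].
move=> [Dx|[i iJ Qx]]; last by exists i => //; right.
by have /finset.set0Pn[i iJ] := J0; exists i => //; left.
Qed.

(* The weight of the digit strings extending [s] that code closed sets
   avoiding [B]. *)
Definition avoid_weight (B : set cantor_space) s := difference T
  (B `|` clopen_of (dead s)) [seq cylinder g : set cantor_space | g <- queue s].

Lemma cylinder_split (f : seq bool) : (cylinder f : set cantor_space) =
  cylinder (rcons f false) `|` cylinder (rcons f true).
Proof.
apply/seteqP; split=> x; last by move=> [] /cylinder_rcons[].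
by move=> xf; case xE : (x (size f)); [right|left]; apply/cylinder_rcons.
Qed.

Lemma big_ord3 (g : 'I_3 -> R) :
  \sum_(i < 3) g i = g (inord 0) + g (inord 1) + g (inord 2).
Proof.
rewrite !big_ord_recl big_ord0 addr0 addrA.
by congr (g _ + g _ + g _); apply: val_inj; rewrite /= inordK.
Qed.

Lemma avoid_weight_split B s :
  avoid_weight B s = \sum_(i < 3) avoid_weight B (rcons s i).
Proof.
rewrite big_ord3.
rewrite /avoid_weight !queue_rcons !dead_rcons {1}queue_head_behead /queue_step !kidsE.
set f := head _ _.
rewrite !cat1s !cat0s !clopen_of_cons !setUA !map_cat.
rewrite [map _ (_ :: _)]/= cylinder_split difference_split [map _ [:: _]]/=.
by rewrite !difference_cat_cons /= !difference_cat_cons !cats0.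
Qed.

Lemma avoid_weight_nil B : T setT = 1 -> avoid_weight B [::] = 1 - T B.
Proof.
move=> T1; rewrite /avoid_weight /= clopen_of_nil setU0.
have -> : cylinder [::] = [set: cantor_space] by apply/seteqP; split.
by rewrite setUT T1 opprK addrC.
Qed.

Lemma avoid_weight_eq0 B s (f : seq bool) : f \in queue s ->
  cylinder f `<=` B -> avoid_weight B s = 0.
Proof.
move=> /splitPr fq fB; rewrite /avoid_weight; case: (queue s) / fq => F1 F2.
rewrite map_cat /= difference_cat_cons difference_subset //.
by move=> x /fB; left.
Qed.

Lemma avoid_weight_dead B s : B `<=` clopen_of (dead s) ->
  avoid_weight B s = weight T s.
Proof. by move=> Bd; rewrite /avoid_weight setUidr. Qed.

Lemma weightE s : weight T s = avoid_weight set0 s.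
Proof. by rewrite avoid_weight_dead. Qed.

Lemma weight_split s : weight T s = \sum_(i < 3) weight T (rcons s i).
Proof.
by rewrite weightE avoid_weight_split; apply: eq_bigr => i _; rewrite -weightE.
Qed.

Hypothesis capT : is_capacity T.
Hypothesis T1 : T setT = 1.

Lemma weight_nil : weight T [::] = 1.
Proof. by rewrite weightE avoid_weight_nil //; have [_ -> _ _ _] := capT; rewrite subr0. Qed.

Lemma weight_ge0 s : 0 <= weight T s.
Proof.
apply: difference_ge0 => //; first by have [] := clopen_of_clopen (dead s).
  by move=> f /mapP[g _ ->]; have [] := cylinder_cantor_clopen g.
by rewrite -size_eq0 size_map size_eq0 queue_neq0.
Qed.

Lemma weight_le1 s : weight T s <= 1.
Proof.
elim/last_ind: s => [|s i]; first by rewrite weight_nil.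
apply: le_trans; rewrite (weight_split s) (bigD1 i) //= lerDl.
by apply: sumr_ge0 => j _; exact: weight_ge0.
Qed.

End DifferenceTheory.

(** * Hitting probabilities *)

Section HittingProbability.
Variables (R : realType) (T : set cantor_space -> R).
Hypothesis T1 : T setT = 1.
Variable mu : probability ternary_borel R.
Hypothesis muE : is_mu_of (weight T) mu.

Local Notation cyl s := (cylinder (s : seq 'I_3) : set ternary_borel).

Lemma measurable_cylinder s : measurable (cyl s).
Proof.
apply: sub_sigma_algebra.
by have [] := @cylinder_clopen (discrete_topology 'I_3) s.
Qed.

Definition avoiding (B : set cantor_space) : set ternary_borel :=
  [set x | ~ (closed_of x `&` B !=set0)].

(** The hypothesis says that [B] depends on the first [k] bits only. The induction is on the number
    [m] of digits missing up to length [N], where every queue string has at least [k] bits; shorter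
    strings inherit measurability and value from their three extensions. *)
Lemma mu_avoiding_cylinder (B : set cantor_space) k :
  (forall f : seq bool, (k <= size f)%N -> cylinder f `<=` B \/ cylinder f `<=` ~` B) ->
  exists N, forall m s, (N <= size s + m)%N ->
    measurable (cyl s `&` avoiding B) /\
    mu (cyl s `&` avoiding B) = (avoid_weight T B s)%:E.
Proof.
move=> hB; have [N depthN] := queue_depth k; exists N.
elim=> [|m IHm] s Ns.
  rewrite addn0 in Ns; have /allP qk := depthN s Ns.
  have [[f fq fB]|nB] := pselect (exists2 f, f \in queue s & cylinder f `<=` B).
    have -> : cyl s `&` avoiding B = set0.
      apply/seteqP; split=> // x [xs]; apply.
      have [y [xy yf]] : closed_of x `&` cylinder f !=set0.
        by apply: (@closed_of_meets x (size s)); rewrite xs.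
      by exists y; split=> //; exact: fB.
    by rewrite (avoid_weight_eq0 _ fq fB) measure0; split.
  have Bd : B `<=` clopen_of (dead s).
    rewrite clopen_of_dead => x Bx [f fq xf].
    have [fB|fB] := hB _ (qk f fq); last exact: (fB x xf).
    by apply: nB; exists f.
  rewrite avoid_weight_dead // (_ : _ `&` _ = cyl s).
    by split; [exact: measurable_cylinder|exact: muE].
  apply/seteqP; split=> [x [//]|x xs]; split=> // -[y [xy By]].
  have := Bd _ By; rewrite clopen_of_dead; apply.
  by have := xy (size s) I; rewrite xs.
have IHi i : measurable (cyl (rcons s i) `&` avoiding B) /\
    mu (cyl (rcons s i) `&` avoiding B) = (avoid_weight T B (rcons s i))%:E.
  by apply: IHm; rewrite size_rcons addSnnS.
pose S i := cyl (rcons s i) `&` avoiding B.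
have SE : cyl s `&` avoiding B = S (inord 0) `|` S (inord 1) `|` S (inord 2).
  apply/seteqP; split=> x.
    move=> [xs xB]; have : cylinder (rcons s (x (size s))) x by apply/cylinder_rcons.
    move: (x (size s)); apply: ord3_cases => xsi; [left; left|left; right|right];
      by split.
  by move=> [[]|] [/cylinder_rcons[xs _] xB].
have disj i j : i <> j -> S i `&` S j = set0.
  move=> ij; apply/seteqP; split=> // x [[/cylinder_rcons[_ xi] _] [/cylinder_rcons[_ xj] _]].
  by apply: ij; rewrite -xi -xj.
have neq (a b : nat) : (a < 3)%N -> (b < 3)%N -> a != b -> inord a <> inord b :> 'I_3.
  by move=> a3 b3 ab /(congr1 (@nat_of_ord 3)); rewrite !inordK // => /eqP; rewrite (negPf ab).
have mS i : measurable (S i) by have [] := IHi i.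
rewrite SE; split; first by apply: measurableU => //; exact: measurableU.
rewrite measureU //; last first.
- by rewrite setIUl !disj ?setU0 //; exact: neq.
- exact: measurableU.
rewrite measureU //; last by rewrite disj //; exact: neq.
rewrite avoid_weight_split big_ord3 !EFinD.
by rewrite -!(proj2 (IHi _)).
Qed.

Lemma mu_avoiding_clopen (B : set cantor_space) k :
  (forall f : seq bool, (k <= size f)%N -> cylinder f `<=` B \/ cylinder f `<=` ~` B) ->
  measurable (avoiding B) /\ mu (avoiding B) = (1 - T B)%:E.
Proof.
move=> /mu_avoiding_cylinder[N /(_ N [::] (leqnn _))].
have -> : cyl [::] `&` avoiding B = avoiding B.
  by apply/seteqP; split=> [x []|x xB] //; split.
by rewrite avoid_weight_nil.
Qed.

Definition neighborhood (Q : set cantor_space) n := clopen_of (level Q n).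

Lemma neighborhoodP Q n (x : cantor_space) :
  neighborhood Q n x <-> tree Q (mkseq x n).
Proof.
split=> [[s]|Qx].
  rewrite mem_filter mem_bitstrings => /andP[/asboolP Qs /eqP <-] xs.
  by rewrite xs.
exists (mkseq x n); last exact: cylinder_mkseq.
by rewrite mem_filter mem_bitstrings size_mkseq eqxx andbT; exact/asboolP.
Qed.

Lemma neighborhood_clopen Q n (f : seq bool) : (n <= size f)%N ->
  cylinder f `<=` neighborhood Q n \/ cylinder f `<=` ~` neighborhood Q n.
Proof.
move=> nf; have eq_on (x y : cantor_space) : cylinder f x -> cylinder f y ->
    mkseq x n = mkseq y n.
  by move=> xf yf; apply: eq_mkseq_le nf _; rewrite xf yf.
have [Qf|nQf] := pselect (tree Q (take n f)).
  left=> x xf; apply/neighborhoodP; move: Qf; rewrite -{1}xf.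
  by rewrite mkseq_take.
right=> x xf /neighborhoodP; rewrite -(mkseq_take x nf) xf; exact: nQf.
Qed.

Lemma neighborhood_decr Q n : neighborhood Q n.+1 `<=` neighborhood Q n.
Proof.
move=> x /neighborhoodP; rewrite mkseqS => Qx; apply/neighborhoodP.
exact: tree_rcons Qx.
Qed.

Lemma bigcap_neighborhood Q : closed Q -> \bigcap_n neighborhood Q n = Q.
Proof.
move=> cQ; apply/seteqP; split=> x Qx; last first.
  by move=> n _; apply/neighborhoodP; exists x; split=> //; exact: cylinder_mkseq.
by apply: closed_cylinderP => // n; apply/neighborhoodP; exact: Qx.
Qed.

(** By compactness, a closed set that meets every neighborhood of [Q] meets [Q] itself. *)
Lemma avoiding_bigcap Q : closed Q ->
  ~` avoiding Q = \bigcap_n ~` avoiding (neighborhood Q n).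
Proof.
move=> cQ; apply/seteqP; split=> x.
  move=> /contrapT[y [xy Qy]] n _; apply; exists y; split=> //.
  by apply/neighborhoodP; exists y; split=> //; exact: cylinder_mkseq.
move=> hx; apply.
have [||n|n|y hy] := @compact_nested cantor_space (fun n => closed_of x `&` neighborhood Q n).
- exact: cantor_space_compact.
- move=> n; apply: closedI; first exact: closed_closed_of.
  by have [] := clopen_of_clopen (level Q n).
- by have := hx n I; rewrite /avoiding /= => /contrapT.
- by apply: setIS; exact: neighborhood_decr.
exists y; split; first by have [] := hy 0%N I.
by rewrite -(bigcap_neighborhood cQ) => n _; have [] := hy n I.
Qed.

Lemma hitting_capacityE Q : hitting_capacity mu Q = mu (~` avoiding Q).
Proof.
rewrite /hitting_capacity /mu_star; congr (mu _); apply/seteqP; split=> x.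
  by move=> [K [[cK K0] KQ] <-]; rewrite /avoiding /= closed_of_code.
move=> /contrapT xQ; exists (closed_of x); last exact: code_closed_of.
by split=> //; split; [exact: closed_closed_of|exact: closed_of_neq0].
Qed.

Lemma hitting_capacity_closed Q : is_capacity T -> closed Q ->
  hitting_capacity mu Q = (T Q)%:E.
Proof.
move=> [_ _ _ _ T_cont] cQ; rewrite hitting_capacityE avoiding_bigcap //.
pose H n := ~` avoiding (neighborhood Q n).
have mH n : measurable (H n).
  by apply: measurableC; have [] := mu_avoiding_clopen (@neighborhood_clopen Q n).
have muH n : mu (H n) = (T (neighborhood Q n))%:E.
  have [mA muA] := mu_avoiding_clopen (@neighborhood_clopen Q n).
  by rewrite /H probability_setC // muA -EFinB opprB addrC subrK.
have TQ : (mu \o H) n @[n --> \oo] --> (T Q)%:E.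
  have -> : mu \o H = (fun n => (T (neighborhood Q n))%:E) by apply: funext => n; exact: muH.
  apply: cvg_EFin; first by near=> n.
  rewrite -[X in T X](bigcap_neighborhood cQ); apply: T_cont.
    by move=> n; have [] := clopen_of_clopen (level Q n).
  exact: neighborhood_decr.
have muQ : (mu \o H) n @[n --> \oo] --> mu (\bigcap_n H n).
  apply: nonincreasing_cvg_mu => //.
  - by rewrite [X in (X < _)%E](muH 0%N) ltry.
  - exact: bigcapT_measurable.
  - apply/nonincreasing_seqP => n; apply/subsetPset => x xH xA; apply: xH => -[y [xy Qy]].
    by apply: xA; exists y; split=> //; exact: neighborhood_decr.
exact: cvg_unique muQ TQ.
Unshelve. all: by end_near.
Qed.

End HittingProbability.

(** * Existence of the measure *)

Section MeasureOfWeights.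
Variables (R : realType) (d : seq 'I_3 -> R).
Hypothesis d_ge0 : forall s, 0 <= d s.
Hypothesis d_nil : d [::] = 1.
Hypothesis d_split : forall s, d s = \sum_(i < 3) d (rcons s i).

(* The unit interval is cut into consecutive intervals of lengths
   [d (rcons s i)], recursively; a point [u] determines the digit string of the
   nested intervals that contain it. *)
Definition offset s (i : 'I_3) : R :=
  if i == 0%N :> nat then 0 else
  if i == 1%N :> nat then d (rcons s (inord 0)) else
  d (rcons s (inord 0)) + d (rcons s (inord 1)).

Definition left_end (s : seq 'I_3) : R :=
  \sum_(j < size s) offset (take j s) (nth ord0 s j).

Lemma left_end_rcons s i : left_end (rcons s i) = left_end s + offset s i.
Proof.
rewrite /left_end size_rcons big_ord_recr /= nth_rcons ltnn eqxx -cats1.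
rewrite take_size_cat //; congr (_ + _); apply: eq_bigr => j _.
by rewrite nth_cat ltn_ord takel_cat // ltnW.
Qed.

Definition next_digit (u : R) s : 'I_3 :=
  if u < left_end s + offset s (inord 1) then inord 0 else
  if u < left_end s + offset s (inord 2) then inord 1 else inord 2.

Fixpoint digit_prefix u n : seq 'I_3 :=
  if n is m.+1 then rcons (digit_prefix u m) (next_digit u (digit_prefix u m))
  else [::].

Definition digits (u : measurableTypeR R) : ternary_borel :=
  fun n => next_digit u (digit_prefix u n).

Lemma mkseq_digits u n : mkseq (digits u : nat -> 'I_3) n = digit_prefix u n.
Proof. by elim: n => // n IHn; rewrite mkseqS IHn. Qed.

Lemma cylinder_digits s u :
  cylinder s (digits u : nat -> 'I_3) <-> digit_prefix u (size s) = s.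
Proof. by rewrite /cylinder /= mkseq_digits. Qed.

Lemma offsetE s : (offset s (inord 0) = 0) *
  (offset s (inord 1) = d (rcons s (inord 0))) *
  (offset s (inord 2) = d (rcons s (inord 0)) + d (rcons s (inord 1))).
Proof. by rewrite /offset !inordK. Qed.

Lemma inord3_eq (a b : nat) : (a < 3)%N -> (b < 3)%N ->
  (inord a == inord b :> 'I_3) = (a == b).
Proof. by move=> a3 b3; rewrite -val_eqE /= !inordK. Qed.

(** Being half open, the three subintervals tile their parent exactly, and a digit of weight zero
    receives the empty interval. *)
Lemma digit_prefix_itv s u : 0 <= u < 1 ->
  digit_prefix u (size s) = s <-> left_end s <= u < left_end s + d s.
Proof.
move=> u01; elim/last_ind: s => [|s i IHs].
  by rewrite /left_end big_ord0 add0r d_nil u01.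
rewrite size_rcons left_end_rcons /=.
have d0 := d_ge0 (rcons s (inord 0)); have d1 := d_ge0 (rcons s (inord 1)).
have d2 := d_ge0 (rcons s (inord 2)).
have ds := d_split s; rewrite big_ord3 in ds.
have digitP : left_end s <= u < left_end s + d s -> next_digit u s = i <->
    left_end s + offset s i <= u < left_end s + offset s i + d (rcons s i).
  move=> /andP[su us].
  rewrite /next_digit !offsetE.
  case: ifPn => [h1|]; last (rewrite -leNgt => h1; case: ifPn => [h2|]; last rewrite -leNgt => h2);
    move: i; apply: ord3_cases; rewrite !offsetE;
    (split=> [/eqP|/andP[? ?]]; [rewrite inord3_eq //= => _; apply/andP; split; lra|
      by [] || (exfalso; lra)]).
split=> [/rcons_inj[ps nd]|iu].
  by apply/digitP; [apply/IHs|rewrite -nd ps].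
have su : left_end s <= u < left_end s + d s.
  by move: i iu {digitP}; apply: ord3_cases; rewrite !offsetE => /andP[? ?]; apply/andP; split; lra.
by rewrite (IHs.2 su) (digitP su).2.
Qed.

Lemma measurable_next_digit s i :
  measurable ([set u | next_digit u s = i] : set (measurableTypeR R)).
Proof.
have mlt c : measurable ([set u : R | u < c] : set (measurableTypeR R)).
  rewrite (_ : [set u | _] = [set` `]-oo, c[]); first exact: measurable_itv.
  by apply/seteqP; split=> u /=; rewrite in_itv.
have -> : [set u | next_digit u s = i] =
   ([set u : R | u < left_end s + offset s (inord 1)] `&` [set u | inord 0 = i]) `|`
   (~` [set u : R | u < left_end s + offset s (inord 1)] `&`
    (([set u : R | u < left_end s + offset s (inord 2)] `&` [set u | inord 1 = i]) `|`
   (~` [set u : R | u < left_end s + offset s (inord 2)] `&` [set u | inord 2 = i]))).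
  apply/seteqP; split=> u; rewrite /= /next_digit; (case: ifP => h1; last case: ifP => h2).
  - by left.
  - by move=> h; right; split=> //; left.
  - by move=> h; right; split=> //; right.
  - by move=> [[]|[]].
  - by move=> [[]|[_ [[]|[]]]].
  - by move=> [[]|[_ [[]|[]]]].
have mc (P : Prop) : measurable ([set u : R | P] : set (measurableTypeR R)).
  have [p|np] := pselect P; first by rewrite (_ : [set _ | _] = setT) //; apply/seteqP; split.
  by rewrite (_ : [set _ | _] = set0) //; apply/seteqP; split.
apply: measurableU; first exact: measurableI.
apply: measurableI; first exact: measurableC.
apply: measurableU; first exact: measurableI.
by apply: measurableI => //; exact: measurableC.
Qed.

Lemma measurable_digit_prefix s :
  measurable ([set u | digit_prefix u (size s) = s] : set (measurableTypeR R)).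
Proof.
elim/last_ind: s => [|s i IHs].
  by rewrite (_ : [set u | _] = setT) //; apply/seteqP; split.
have -> : [set u | digit_prefix u (size (rcons s i)) = rcons s i] =
    [set u | digit_prefix u (size s) = s] `&` [set u | next_digit u s = i].
  apply/seteqP; split=> u /=; rewrite size_rcons /=.
    by move=> /rcons_inj[h]; rewrite h.
  by move=> [-> ->].
by apply: measurableI => //; exact: measurable_next_digit.
Qed.

(** An open set is the union of the cylinders it contains, and there are only countably many
    strings; [unpickle] enumerates them. *)
Lemma measurable_digits : measurable_fun setT digits.
Proof.
apply: (@measurability _ _ _ ternary_borel setT digits (@open ternary_space)).
  by [].
move=> _ [U oU <-].
rewrite setTI.
pose cut n : set (measurableTypeR R) := if unpickle n is Some s then
  if `[< cylinder (s : seq 'I_3) `<=` U >]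
  then [set u | digit_prefix u (size s) = s] else set0 else set0.
have -> : digits @^-1` U = \bigcup_n cut n.
  apply/seteqP; split=> u.
    move=> Uu; have [n nU] := @cylinder_basis (discrete_topology 'I_3) _ _ oU Uu.
    exists (pickle (digit_prefix u n)) => //; rewrite /cut pickleK.
    rewrite -mkseq_digits asboolT //=.
    by rewrite size_mkseq mkseq_digits.
  move=> [n _]; rewrite /cut; case: unpickle => // s; case: asboolP => // sU us.
  by apply: sU; apply/cylinder_digits.
apply: bigcupT_measurable => n; rewrite /cut.
case: unpickle => // s; case: asboolP => // _; exact: measurable_digit_prefix.
Qed.

Lemma left_end_bounds s : 0 <= left_end s /\ left_end s + d s <= 1.
Proof.
elim/last_ind: s => [|s i [lo hi]].
  by rewrite /left_end big_ord0 add0r d_nil.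
have d0 := d_ge0 (rcons s (inord 0)); have d1 := d_ge0 (rcons s (inord 1)).
have d2 := d_ge0 (rcons s (inord 2)); have ds := d_split s; rewrite big_ord3 in ds.
by rewrite left_end_rcons; move: i; apply: ord3_cases; rewrite !offsetE; split; lra.
Qed.

Lemma exists_measure : exists mu : probability ternary_borel R, is_mu_of d mu.
Proof.
have lt01 : (0 : R) < 1 by [].
exists (distribution (uniform_prob lt01) (mfun_Sub (mem_set measurable_digits))) => s.
rewrite /distribution /pushforward /=.
have -> : digits @^-1` cylinder s = [set u | digit_prefix u (size s) = s].
  by apply/seteqP; split=> u /cylinder_digits.
set E : set (measurableTypeR R) := [set u | _]; have mE : measurable E := measurable_digit_prefix s.
pose I : set (measurableTypeR R) := [set` `[left_end s, left_end s + d s[ ].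
have mI : measurable I := measurable_itv _.
rewrite /uniform_prob integral_uniform_pdf.
rewrite (eq_integral (cst 1%E)); last first.
  move=> u; rewrite inE => -[_]; rewrite /= in_itv /uniform_pdf /= => ->.
  by rewrite subr0 invr1.
have mE01 : measurable (E `&` [set` `[0, 1]]) by apply: measurableI => //; exact: measurable_itv.
rewrite integral_cst // mul1e.
have I01 u : I u -> 0 <= u < 1.
  have [lo hi] := left_end_bounds s; rewrite /I /= in_itv /= => /andP[? ?].
  by apply/andP; split; lra.
have IE u : 0 <= u < 1 -> E u <-> I u.
  by move=> u01; rewrite /I /= in_itv; exact: digit_prefix_itv.
have muI : lebesgue_measure I = (d s)%:E.
  rewrite lebesgue_measure_itv /= lte_fin ltrDl; case: ltP => [_|ds].
    by rewrite -EFinD addrC addKr.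
  by congr EFin; apply/le_anti; rewrite d_ge0 ds.
(* [E] and [I] agree on [0, 1) and [I] lies inside it. On [0, 1] they can differ only at the point
   1, which is a null set. *)
apply/le_anti/andP; split.
  rewrite -muI -(measureU0 mI (measurable_set1 1) (lebesgue_measure_set1 1)).
  apply: le_measure; rewrite ?inE //; first exact: measurableU.
  move=> u [Eu]; rewrite /= in_itv /= => /andP[u0]; rewrite le_eqVlt => /orP[/eqP u1|u1].
    by right.
  by left; apply/IE => //; rewrite u0 u1.
rewrite -muI; apply: le_measure; rewrite ?inE // => u Iu; split.
  by apply/IE => //; exact: I01.
by have /andP[u0 u1] := I01 u Iu; rewrite /= in_itv /= u0 ltW.
Qed.

End MeasureOfWeights.

Theorem theorem5 (R : realType) (T : set cantor_space -> R) :
  is_capacity T -> T [set: cantor_space] = 1 -> computable_capacity T ->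
  exists d : seq 'I_3 -> R,
    [/\ (forall s, 0 <= d s <= 1),
        computable_real_fun code_tritstring d,
        d [::] = 1,
        (forall s, d s = \sum_(i < 3) d (rcons s i)) &
        (exists mu : probability ternary_borel R, is_mu_of d mu) /\
        forall mu : probability ternary_borel R, is_mu_of d mu ->
          forall Q : set cantor_space, closed Q ->
            (T Q)%:E = hitting_capacity mu Q].
Proof.
move=> capT T1 [F [compF FT]].
have d_ge0 := weight_ge0 capT.
have d_nil := weight_nil capT T1.
have compT : computable_real_fun code_bitstrings (fun L => T (clopen_of L)).
  have -> : (fun L => T (clopen_of L)) = (fun L => F (clopen_of L)).
    by apply: funext => L; rewrite FT //; exact: clopen_of_clopen.
  exact: compF.
exists (weight T); split=> //.
- by move=> s; rewrite d_ge0 weight_le1.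
- apply: computable_weight => // L; have [T01 _ _ _ _] := capT.
  by have /andP[] := T01 _ (proj2 (clopen_of_clopen L)).
- exact: weight_split.
split; first by apply: exists_measure => //; exact: weight_split.
by move=> mu muE Q cQ; rewrite (hitting_capacity_closed T1 muE capT cQ).
Qed.
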